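(* Let $d\ge1$, $\delta>0$, and let $\varphi$ be a random vector in $\mathbb{S}^{d-1}$ for which there exist constants $\alpha\ge1$ and $s>0$ with $$\Pr\big(|\langle x,\varphi\rangle|\le t\big)\le\alpha t^s\quad\text{for all }0\le t\le1\text{ and all }x\in\mathbb{S}^{d-1}.$$ Let $\varphi_1,\dots,\varphi_N$ be i.i.d. copies of $\varphi$, and $\epsilon_1,\dots,\epsilon_N$ i.i.d. uniform on $[-\delta,\delta]$, independent of the $\varphi_n$. Let $P_N=\bigcap_{n=1}^N\{u\in\mathbb{R}^d:|\langle u,\varphi_n\rangle-\epsilon_n|\le\delta\}$ and $W_N=\sup\{\|u\|:u\in P_N\}$. Then for all $N\ge(d+2)/s$, $$\mathbb{E}|W_N|^2\le\frac{10^5\delta^2d^2(2\alpha)^{2/s}\ln^2\!\big(16(2\alpha)^{1/s}\big)}{(N+1)(N+2)}+\delta^2\,32^{d+1}(2\alpha)^{(d+1)/s}\Big(\frac12\Big)^N.$$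
   Context: $W_N$ is the worst case error of consistent reconstruction: for any $x\in\mathbb{R}^d$ with measurements $q_n=\langle x,\varphi_n\rangle+\epsilon_n$, every $\tilde x$ satisfying $|\langle\tilde x,\varphi_n\rangle-q_n|\le\delta$ for all $n$ has $\|x-\tilde x\|\le W_N$, and $W_N$ is the supremum of such errors. *)

(* Defs.v *)
From HB Require Import structures.
From mathcomp Require Import all_boot all_order all_algebra.
From mathcomp Require Import all_classical all_reals all_analysis.
Set Implicit Arguments. Unset Strict Implicit. Unset Printing Implicit Defensive.
Import Order.TTheory GRing.Theory Num.Theory.
Local Open Scope classical_set_scope.
Local Open Scope ring_scope.

Definition vdot {R : realType} {d : nat} (u v : 'rV[R]_d) : R :=
  \sum_(i < d) u 0 i * v 0 i.
Definition vnorm {R : realType} {d : nat} (v : 'rV[R]_d) : R :=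
  Num.sqrt (vdot v v).

Definition vec_cyl (R : realType) (d : nat) : set (set 'rV[R]_d) :=
  fun S => exists (i : 'I_d) (B : set R), measurable B /\ S = [set v | B (v 0 i)].
Definition vec_borel (R : realType) (d : nat) : set (set 'rV[R]_d) :=
  <<s [set: 'rV[R]_d], @vec_cyl R d >>.

Definition sigma_vec {T : Type} {R : realType} {d : nat} (X : T -> 'rV[R]_d)
  : set (set T) := fun A => exists S, @vec_borel R d S /\ A = X @^-1` S.
Definition sigma_real {T : Type} {R : realType} (X : T -> R) : set (set T) :=
  fun A => exists B : set R, measurable B /\ A = X @^-1` B.

Definition mutually_independent {dT : measure_display} {T : measurableType dT}
  {R : realType} (P : probability T R) {I : finType} (F : I -> set (set T)) :=
  forall (J : {set I}) (A : I -> set T),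
    (forall i, i \in J -> F i (A i)) ->
    P (\bigcap_(i in [set i | i \in J]) A i) = (\prod_(i in J) P (A i))%E.

Definition vec_measurable {dT : measure_display} {T : measurableType dT}
  {R : realType} {d : nat} (X : T -> 'rV[R]_d) :=
  forall i : 'I_d, measurable_fun setT (fun t => X t 0 i).

Definition PN {R : realType} {d N : nat} (phi : 'I_N -> 'rV[R]_d) (eps : 'I_N -> R)
  (delta : R) : set 'rV[R]_d :=
  [set u | forall n : 'I_N, `|vdot u (phi n) - eps n| <= delta].
Definition WN {R : realType} {d N : nat} (phi : 'I_N -> 'rV[R]_d) (eps : 'I_N -> R)
  (delta : R) : \bar R :=
  ereal_sup [set (vnorm u)%:E | u in PN phi eps delta].

(* Main.v *)
(* Write c = (2 alpha)^(1/s), so that P(|<x, phi>| <= t) <= (t c)^s / 2.  If W_N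
   is at least a, the convex set P_N, which almost surely contains 0, contains a
   vector of norm a; hence some point v of a fine net of the unit ball satisfies
   all N slab constraints, slightly relaxed, at scale a.

   For a <= 16 delta c a fixed v does so with probability at most
   exp(-N a / (32 delta c)).  Against a net of at most (16 c)^(2 d) points this
   becomes effective at a0 = 96 d ln(16 c) delta c / N, and summing over dyadic
   levels 2^i a0 gives the first term of the bound.

   For larger norms the constraints force |<u, phi_n>| <= 2 delta for all n, and
   |<v, phi_n>| <= 4 delta for all n has probability at most
   2^-N (4 delta c / |v|)^(d+2).  A union bound over a net of spacing 2 delta
   would diverge logarithmically.  But the whole segment [0, u] lies in the set
   of such vectors, so many net points are hit at once, and the growth of |u|^2
   along the segment can be charged to distinct net points.  This gains one
   power of |u| and gives the second term.

   The nets consist of lattice points truncated towards 0 and are counted by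
   their l1 norm. *)
Require Import Defs.
From HB Require Import structures.
From mathcomp Require Import all_boot all_order all_algebra.
From mathcomp Require Import all_classical all_reals all_analysis.
From mathcomp Require Import measurable_realfun zify ring lra.
Import Order.TTheory GRing.Theory Num.Theory.
Set Implicit Arguments.
Unset Strict Implicit.
Unset Printing Implicit Defensive.
Local Open Scope classical_set_scope.
Local Open Scope ring_scope.

(** * Euclidean geometry and nets *)

Lemma vdotC (R : realType) d (u v : 'rV[R]_d) : vdot u v = vdot v u.
Proof. by apply: eq_bigr => i _; rewrite mulrC. Qed.

Lemma vdotDl (R : realType) d (u v w : 'rV[R]_d) :
  vdot (u + v) w = vdot u w + vdot v w.
Proof. by rewrite -big_split; apply: eq_bigr => i _; rewrite !mxE mulrDl. Qed.

Lemma vdotZl (R : realType) d (a : R) (u v : 'rV[R]_d) :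
  vdot (a *: u) v = a * vdot u v.
Proof. by rewrite mulr_sumr; apply: eq_bigr => i _; rewrite !mxE mulrA. Qed.

Lemma vdotBl (R : realType) d (u v w : 'rV[R]_d) :
  vdot (u - v) w = vdot u w - vdot v w.
Proof. by rewrite vdotDl -scaleN1r vdotZl mulN1r. Qed.

Lemma vdot_ge0 (R : realType) d (u : 'rV[R]_d) : 0 <= vdot u u.
Proof. by apply: sumr_ge0 => i _; rewrite -expr2 sqr_ge0. Qed.

Lemma vnorm_ge0 (R : realType) d (u : 'rV[R]_d) : 0 <= vnorm u.
Proof. exact: sqrtr_ge0. Qed.

Lemma sqr_vnorm (R : realType) d (u : 'rV[R]_d) : vnorm u ^+ 2 = vdot u u.
Proof. by rewrite sqr_sqrtr// vdot_ge0. Qed.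

Lemma vdot_cauchy_schwarz (R : realType) d (u v : 'rV[R]_d) :
  `|vdot u v| <= vnorm u * vnorm v.
Proof.
rewrite -(@ler_pXn2r _ 2)// ?nnegrE ?mulr_ge0 ?vnorm_ge0//.
rewrite real_normK ?num_real// exprMn !sqr_vnorm.
(* The square expands to [b * (a * b - c ^+ 2)]; cancelling [b > 0] gives the claim, and [b = 0]
   forces [v = 0]. *)
have := vdot_ge0 (vdot v v *: u - vdot u v *: v).
rewrite vdotBl !vdotZl !(vdotC _ (_ - _)) !vdotBl !vdotZl (vdotC v u).
set a := vdot u u; set b := vdot v v; set c := vdot u v => H.
have b0 : 0 <= b := vdot_ge0 v.
have [b1|b1] := eqVneq b 0.
  have vi0 : forall i, v 0 i = 0.
    move=> i; apply/eqP; rewrite -sqrf_eq0; apply/eqP.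
    have := b1; rewrite /b /vdot; under eq_bigr do rewrite -expr2.
    by move/psumr_eq0P => /(_ (fun j _ => sqr_ge0 _)); exact.
  suff -> : c = 0 by rewrite expr0n/= b1 mulr0.
  by apply: big1 => i _; rewrite vi0 mulr0.
have bp : 0 < b by rewrite lt_def b1.
have {}H : 0 <= b * (a * b - c ^+ 2) by move: H; congr (_ <= _); ring.
by rewrite -subr_ge0 -(pmulr_rge0 _ bp).
Qed.

Lemma vnormZ (R : realType) d (a : R) (u : 'rV[R]_d) :
  0 <= a -> vnorm (a *: u) = a * vnorm u.
Proof.
move=> a0; rewrite /vnorm vdotZl vdotC vdotZl mulrA -expr2.
by rewrite sqrtrM ?sqr_ge0// sqrtr_sqr ger0_norm.
Qed.

Lemma ler_vnormD (R : realType) d (u v : 'rV[R]_d) :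
  vnorm (u + v) <= vnorm u + vnorm v.
Proof.
rewrite -(@ler_pXn2r _ 2)// ?nnegrE ?addr_ge0 ?vnorm_ge0//.
rewrite sqr_vnorm vdotDl !(vdotC _ (u + v)) !vdotDl (vdotC v u) sqrrD !sqr_vnorm.
have := le_trans (ler_norm _) (vdot_cauchy_schwarz u v); lra.
Qed.

Lemma l1_le_vnorm (R : realType) d (u : 'rV[R]_d) :
  \sum_i `|u 0 i| <= Num.sqrt d%:R * vnorm u.
Proof.
have := vdot_cauchy_schwarz (\row_i `|u 0 i|) (const_mx 1).
have -> : vdot (\row_i `|u 0 i|) (const_mx 1) = \sum_i `|u 0 i|.
  by apply: eq_bigr => i _; rewrite !mxE mulr1.
have -> : vnorm (const_mx 1 : 'rV[R]_d) = Num.sqrt d%:R.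
  by congr Num.sqrt; rewrite /vdot; under eq_bigr do rewrite !mxE mulr1;
     rewrite sumr_const card_ord.
have -> : vnorm (\row_i `|u 0 i|) = vnorm u.
  by congr Num.sqrt; apply: eq_bigr => i _; rewrite !mxE -expr2 real_normK ?num_real.
by rewrite mulrC; apply: le_trans; rewrite ler_norm.
Qed.

(** From exp(-1/6) >= 5/6 one gets e <= (6/5)^6 = 2.98... *)
Lemma expR1_le3 (R : realType) : expR 1 <= 3 :> R.
Proof.
have -> : expR 1 = expR (6^-1) ^+ 6 :> R.
  by rewrite -expRM_natl; congr expR; rewrite mulfV.
have -> : expR (6^-1) = (expR (- 6^-1))^-1 :> R by rewrite expRN invrK.
have h : 5/6 <= expR (- 6^-1) :> R.
  by apply: le_trans (expR_ge1Dx _); lra.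
apply: (@le_trans _ _ ((5/6)^-1 ^+ 6)); last by lra.
by rewrite ler_pXn2r ?nnegrE ?invr_ge0 ?expR_ge0// lef_pV2 ?posrE ?expR_gt0//; lra.
Qed.

(** Sign and magnitude are stored separately, so that truncation towards 0 acts on magnitudes and
    the l1 norm is [h] times the sum of the indices. A zero coordinate has two codes, which is
    harmless for an upper count. *)
Definition signed_grid (R : realType) d m (h : R)
    (f : {ffun 'I_d -> 'I_m.+1 * bool}) : 'rV[R]_d :=
  \row_i (h * ((-1) ^+ (f i).2 * (f i).1%:R)).

(** Exponential weighting. With z = y / (1 + y), a counted [f] with index sum k <= d y satisfies
    z^(-k) = (1 + 1/y)^k <= exp(k / y) <= 3^d, so 3^d z^k >= 1. The sum of these weights over all
    [f] factorises over coordinates, each factor being at most 3 * 2 * (1 + y) by the geometric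
    series. The bound is uniform in the cutoff [m]. *)
Lemma l1_ball_count (R : realType) d m (y : R) : 0 < y ->
  (#|[set f : {ffun 'I_d -> 'I_m.+1 * bool} |
      (\sum_i (f i).1)%:R <= d%:R * y]%SET|)%:R <= (6 * (1 + y)) ^+ d.
Proof.
move=> y0; set A := [set f | _]%SET.
pose q := 1 + y^-1; pose z := y / (1 + y).
have y1 : 0 < 1 + y by rewrite addr_gt0.
have qz : q^-1 = z by rewrite /q /z; field; rewrite !gt_eqF.
have q0 : 0 < q by rewrite addr_gt0 ?invr_gt0.
have z0 : 0 <= z by rewrite -qz invr_ge0 ltW.
have weight f : f \in A -> 1 <= 3 ^+ d * \prod_i z ^+ (f i).1 :> R.
  rewrite inE => fA.
  rewrite -expr_sum -qz exprVn; set k := (\sum_i _)%N.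
  rewrite ler_pdivlMr ?exprn_gt0// mul1r.
  apply: (@le_trans _ _ (expR y^-1 ^+ k)).
    by apply: lerXn2r; rewrite ?nnegrE ?expR_ge0 ?(ltW q0)// /q expR_ge1Dx.
  rewrite -expRM_natl; apply: (@le_trans _ _ (expR (d%:R * 1))).
    by rewrite ler_expR mulr1 ler_pdivrMr.
  by rewrite expRM_natl; apply: lerXn2r; rewrite ?nnegrE ?expR_ge0// expR1_le3.
have geom : \sum_(p : 'I_m.+1 * bool) z ^+ p.1 <= 2 * (1 + y).
  rewrite -(pair_bigA _ (fun (a : 'I_m.+1) (b : bool) => z ^+ a))/=.
  under eq_bigr do rewrite sumr_const card_bool -mulr_natl.
  rewrite -mulr_sumr ler_pM2l//.
  have z1 : 1 - z = (1 + y)^-1 by rewrite /z; field; rewrite gt_eqF.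
  have : (1 - z) * \sum_(i < m.+1) z ^+ i <= 1.
    by rewrite -opprB mulNr -subrX1 opprB gerBl exprn_ge0.
  by rewrite z1 mulrC ler_pdivrMr// mul1r.
have -> : (#|A|)%:R = \sum_(f in A) 1 :> R by rewrite sumr_const.
apply: (@le_trans _ _ (\sum_(f in A) 3 ^+ d * \prod_i z ^+ (f i).1)).
  by apply: ler_sum => f; exact: weight.
apply: (@le_trans _ _ (\sum_(f : {ffun 'I_d -> 'I_m.+1 * bool})
    3 ^+ d * \prod_i z ^+ (f i).1)).
  rewrite [leRHS](bigID (mem A))/= lerDl sumr_ge0// => f _.
  by rewrite mulr_ge0 ?exprn_ge0// prodr_ge0// => i _; rewrite exprn_ge0.
rewrite -mulr_sumr -(bigA_distr_bigA (fun _ (p : 'I_m.+1 * bool) => z ^+ p.1)).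
rewrite prodr_const card_ord -exprMn; apply: lerXn2r; rewrite ?nnegrE ?mulr_ge0 ?(ltW y1)//.
  by rewrite sumr_ge0// => p _; rewrite exprn_ge0.
by move: geom; lra.
Qed.

(** Truncate each coordinate towards 0 on a lattice of mesh h = rho / sqrt d. Norms do not grow, and
    an error below h per coordinate gives a Euclidean error below rho. The l1 norm is at most sqrt d
    * L = d * (L / rho) * h, so [l1_ball_count] applies with y = L / rho. *)
Lemma ball_net (R : realType) d (L rho : R) : (0 < d)%N -> 0 < L -> 0 < rho ->
  exists S : seq 'rV[R]_d, (size S)%:R <= (6 * (1 + L / rho)) ^+ d /\
    forall u, vnorm u <= L ->
      exists v, [/\ v \in S, vnorm v <= vnorm u & vnorm (u - v) < rho].
Proof.
move=> d0 L0 rho0; set y := L / rho.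
have sd0 : 0 < Num.sqrt (d%:R : R) by rewrite sqrtr_gt0 ltr0n.
have sdd : Num.sqrt (d%:R : R) ^+ 2 = d%:R by rewrite sqr_sqrtr.
pose h := rho / Num.sqrt d%:R.
have h0 : 0 < h by rewrite divr_gt0.
pose m := Num.truncn (L / h).
pose A := [set f : {ffun 'I_d -> 'I_m.+1 * bool} |
      (\sum_i (f i).1)%:R <= d%:R * y]%SET.
exists [seq signed_grid h f | f <- enum A]; split.
  by rewrite size_map -cardE l1_ball_count// divr_gt0.
move=> u uL.
have uiL i : `|u 0 i| <= L.
  apply: le_trans uL; rewrite -(@ler_pXn2r _ 2)// ?nnegrE ?vnorm_ge0//.
  rewrite sqr_vnorm real_normK ?num_real// /vdot (bigD1 i)//= -expr2 lerDl.
  by apply: sumr_ge0 => j _; rewrite -expr2 sqr_ge0.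
have kP i : (Num.truncn (`|u 0%R i| / h)%R < m.+1)%N.
  by rewrite ltnS le_truncn// ler_pM2r ?invr_gt0.
pose f := [ffun i => (Ordinal (kP i), u 0 i < 0)].
have trunc i : (Num.truncn (`|u 0 i| / h))%:R * h <= `|u 0 i| < 
    ((Num.truncn (`|u 0 i| / h))%:R + 1) * h.
  have /andP[] := @truncn_itv _ (`|u 0 i| / h) ltac:(by rewrite divr_ge0 ?(ltW h0)).
  by rewrite ler_pdivlMr// ltr_pdivrMr// -natr1 => -> ->.
have us i : u 0 i = (-1) ^+ (u 0 i < 0)%R * `|u 0 i|.
  by rewrite -realEsign ?num_real.
exists (signed_grid h f); split.
- apply: map_f; rewrite mem_enum inE.
  rewrite natr_sum; apply: (@le_trans _ _ (\sum_i `|u 0 i| / h)).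
    apply: ler_sum => i _; rewrite ffunE/= ler_pdivlMr//.
    by case/andP: (trunc i).
  rewrite -mulr_suml ler_pdivrMr//.
  apply: (le_trans (l1_le_vnorm u)).
  have -> : d%:R * y * h = Num.sqrt d%:R * L.
    rewrite /y /h; move: (Num.sqrt _) sdd sd0 => sd <- sd0.
    by field; rewrite !gt_eqF.
  by rewrite ler_pM2l.
- rewrite -(@ler_pXn2r _ 2)// ?nnegrE ?vnorm_ge0// !sqr_vnorm /vdot.
  apply: ler_sum => i _; rewrite -!expr2 -[leLHS]real_normK ?num_real//.
  rewrite -[leRHS]real_normK ?num_real// ler_pXn2r ?nnegrE//.
  rewrite mxE ffunE/= normrM (ger0_norm (ltW h0)) normrMsign normr_nat mulrC.
  by case/andP: (trunc i).
- rewrite -(@ltr_pXn2r _ 2)// ?nnegrE ?vnorm_ge0 ?(ltW rho0)// sqr_vnorm /vdot.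
  have -> : rho ^+ 2 = \sum_(i < d) h ^+ 2.
    rewrite sumr_const card_ord -mulr_natl /h.
    move: (Num.sqrt _) sdd sd0 => sd <- sd0; field; by rewrite gt_eqF.
  (* Strictness of the sum needs at least one coordinate, hence [0 < d]. *)
  apply: ltr_sum; first by apply/hasP; exists (Ordinal d0); rewrite ?mem_index_enum.
  move=> i _; rewrite -expr2 -real_normK ?num_real// ltr_pXn2r ?nnegrE ?(ltW h0)//.
  rewrite !mxE ffunE/= [in X in X - _]us mulrCA -mulrBr normrMsign ger0_norm.
    by case/andP: (trunc i) => _; lra.
  by rewrite subr_ge0 mulrC; case/andP: (trunc i).
Qed.

(** * Dyadic shells and the geometry of the consistent set *)

Lemma le_sum_sub_seq (R : realType) (I : eqType) (s V : seq I) (g : I -> R) :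
  uniq s -> {subset s <= V} -> (forall i, 0 <= g i) ->
  \sum_(i <- s) g i <= \sum_(i <- V) g i.
Proof.
elim: s V => [|x s IH] V /=; first by rewrite big_nil => _ _ g0; apply: sumr_ge0.
move=> /andP[xs us] sV g0.
have xV : x \in V by apply: sV; rewrite mem_head.
rewrite big_cons (perm_big _ (perm_to_rem xV)) big_cons lerD2l IH// => y ys.
have /sV : y \in x :: s by rewrite inE ys orbT.
rewrite (perm_mem (perm_to_rem xV)) inE => /predU1P[yx|//].
by rewrite -yx ys in xs.
Qed.

(* The points at heights L, L + rho, L + 2 rho, ... of the segment [0, u] have
   distinct net approximations, since these approximations lie in disjoint
   spherical shells.  Charging the growth of the squared height to them gains
   the factor rho / L over a plain union bound. *)
Lemma dyadic_block (R : realType) d (L rho : R) (V : seq 'rV[R]_d)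
    (u : 'rV[R]_d) (g : 'rV[R]_d -> R) : 0 < L -> 0 < rho ->
  (forall x, vnorm x <= 2 * L ->
    exists v, [/\ v \in V, vnorm v <= vnorm x & vnorm (x - v) < rho]) ->
  (forall v, 0 <= g v) ->
  (forall th v, 0 <= th <= 1 -> vnorm (th *: u - v) < rho -> L - rho < vnorm v ->
    rho * (2 * vnorm v + 3 * rho) <= g v) ->
  Num.min (vnorm u) (2 * L) ^+ 2 - Num.min (vnorm u) L ^+ 2 <= \sum_(v <- V) g v.
Proof.
move=> L0 rho0 net g0 gP; set w := vnorm u.
have [wL|Lw] := leP w L.
  by rewrite min_l ?subrr ?sumr_ge0//; move: wL L0; lra.
set W := Num.min w (2 * L).
have LW : L < W by rewrite lt_min Lw/=; move: L0; lra.
have [Ww W2L] : W <= w /\ W <= 2 * L by rewrite !ge_min !lexx orbT.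
have w0 : 0 < w by rewrite (lt_trans L0).
(* The heights [t 0 = L], ..., [t K] stay below [W], while [t K.+1] reaches it, so the increments of
   [t ^+ 2] cover all of [W ^+ 2 - L ^+ 2]. *)
pose K := Num.truncn ((W - L) / rho).
pose t (j : nat) := L + rho * j%:R.
have /andP[K1 K2] : K%:R <= (W - L) / rho < K.+1%:R.
  by apply: truncn_itv; rewrite divr_ge0 ?(ltW rho0)// subr_ge0 ltW.
have t0 j : 0 <= t j by rewrite addr_ge0 ?(ltW L0)// mulr_ge0 ?(ltW rho0).
have tW j : (j <= K)%N -> t j <= W.
  move=> jK; have : j%:R <= (W - L) / rho by apply: le_trans K1; rewrite ler_nat.
  by rewrite ler_pdivlMr// /t; lra.
have WtK : W <= t K.+1.
  by move: K2; rewrite ltr_pdivrMr// /t; lra.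
have /choice[v vP] : forall j, exists v, (j <= K)%N ->
    [/\ v \in V, t j - rho < vnorm v <= t j & vnorm ((t j / w) *: u - v) < rho].
  move=> j; have [jK|] := leqP j K; last by exists 0.
  have nt : vnorm ((t j / w) *: u) = t j.
    by rewrite vnormZ ?divr_ge0 ?(ltW w0)// divfK// gt_eqF.
  have [|v [vV vt dv]] := net ((t j / w) *: u).
    by rewrite nt (le_trans (tW _ jK)).
  exists v => _; split=> //; apply/andP; split; last by rewrite -nt.
  rewrite ltrBlDr -{1}nt.
  by apply: le_lt_trans (_ : vnorm v + vnorm ((t j / w) *: u - v) < _);
    [rewrite -{1}(subrK v ((t j / w) *: u)) addrC ler_vnormD | rewrite ltrD2l].
(* The shells []t j - rho, t j]] containing the norms of the [v j] are disjoint, which makes the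
   [v j] distinct. *)
have lt_shell j k : (j < k)%N -> t j <= t k - rho.
  rewrite -(ler_nat R) -natr1 => jk; rewrite /t.
  have := ler_wpM2l (ltW rho0) jk; lra.
have vinj : {in iota 0 K.+1 &, injective v}.
  move=> j k; rewrite !mem_iota !add0n !ltnS /= => /vP[_ /andP[j1 j2] _].
  move=> /vP[_ /andP[k1 k2] _] vjk; rewrite vjk in j1 j2.
  apply/eqP; case: ltngtP => // /lt_shell.
    by move=> h; move: (lt_le_trans k1 j2); rewrite ltNge h.
  by move=> h; move: (lt_le_trans j1 k2); rewrite ltNge h.
apply: le_trans (_ : \sum_(x <- map v (iota 0 K.+1)) g x <= _); last first.
  apply: le_sum_sub_seq => //; first by rewrite map_inj_in_uniq// iota_uniq.
  move=> _ /mapP[j + ->]; rewrite mem_iota add0n ltnS/= => /vP[].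
  by [].
rewrite big_map.
apply: (@le_trans _ _ (\sum_(0 <= j < K.+1) (t j.+1 ^+ 2 - t j ^+ 2))).
  rewrite telescope_sumr// lerB//; last by rewrite /t mulr0 addr0.
  by apply: lerXn2r; rewrite ?nnegrE ?(le_trans (ltW L0) (ltW LW)).
rewrite !big_seq; apply: ler_sum => j; rewrite mem_iota subn0 add0n ltnS /= => jK.
have [_ /andP[j1 j2] j3] := vP j jK.
apply: le_trans (gP (t j / w) (v j) _ j3 _); last 1 first.
- by apply: le_lt_trans j1; rewrite lerD2r /t lerDl mulr_ge0 ?(ltW rho0).
(* Since [T < vnorm (v j) + rho], the increment [rho * (2 * T + rho)] is at most
   [rho * (2 * vnorm (v j) + 3 * rho)]. *)
- rewrite /t -natr1; set T := L + rho * j%:R.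
  have -> : (L + rho * (j%:R + 1)) ^+ 2 - T ^+ 2 = rho * (2 * T + rho).
    by rewrite /T; ring.
  by rewrite ler_pM2l//; rewrite -/(t j) in T * ; move: j1; rewrite /T; lra.
- by rewrite divr_ge0 ?(ltW w0)//= ler_pdivrMr// mul1r (le_trans (tW _ jK)).
Qed.

Lemma dyadic_telescope (R : realType) (w L : R) (b : nat -> R) n :
  (forall i, Num.min w (2 * (2 ^+ i * L)) ^+ 2 - Num.min w (2 ^+ i * L) ^+ 2 <= b i) ->
  Num.min w (2 ^+ n * L) ^+ 2 <= Num.min w L ^+ 2 + \sum_(i < n) b i.
Proof.
move=> H; elim: n => [|n IH]; first by rewrite big_ord0 addr0 expr0 mul1r.
have -> : 2 ^+ n.+1 * L = 2 * (2 ^+ n * L) by rewrite (exprS 2 n) mulrA.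
by rewrite big_ord_recr/=; move: (H n) IH; lra.
Qed.

Lemma exists_dyadic_ge (R : realType) (w a : R) : 0 < a -> exists n, w <= 2 ^+ n.+1 * a.
Proof.
move=> a0; exists (Num.truncn (w / a)).
rewrite -ler_pdivrMr//; apply: le_trans (ltW (truncnS_gt _)) _.
by rewrite -natrX ler_nat ltnW// ltn_expl.
Qed.

(** The residual at [th *: u] is the convex combination of the residuals at [u] and at 0, and 0 is
    consistent because [|eps n| <= delta]. *)
Lemma PN_scale (R : realType) d N (phi : 'I_N -> 'rV[R]_d) (eps : 'I_N -> R)
    (delta th : R) (u : 'rV[R]_d) :
  (forall n, `|eps n| <= delta) -> PN phi eps delta u -> 0 <= th <= 1 ->
  PN phi eps delta (th *: u).
Proof.
move=> epsd uP /andP[th0 th1] n; rewrite vdotZl.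
have -> : th * vdot u (phi n) - eps n =
    th * (vdot u (phi n) - eps n) - (1 - th) * eps n by ring.
apply: (le_trans (ler_normB _ _)).
have un : `|vdot u (phi n) - eps n| <= delta := uP n.
have th1' : 0 <= 1 - th by rewrite subr_ge0.
rewrite !normrM (ger0_norm th0) (ger0_norm th1').
have := ler_wpM2l th0 un; have := ler_wpM2l th1' (epsd n); lra.
Qed.

(** The point of norm [a] on the segment [0, u] is consistent. Replacing its direction by a net
    point within [r] moves each inner product by at most [a * r], so one net of the unit ball serves
    all scales [a]. *)
Lemma PN_net_point (R : realType) d N (phi : 'I_N -> 'rV[R]_d) (eps : 'I_N -> R)
    (delta a r : R) (V : seq 'rV[R]_d) (u : 'rV[R]_d) :
  (forall n, vnorm (phi n) = 1) -> (forall n, `|eps n| <= delta) ->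
  0 < a -> PN phi eps delta u -> a <= vnorm u ->
  (forall x, vnorm x <= 1 ->
    exists v, [/\ v \in V, vnorm v <= vnorm x & vnorm (x - v) < r]) ->
  exists v, [/\ v \in V, 1 - r < vnorm v &
    forall n, `|a * vdot v (phi n) - eps n| <= delta + a * r].
Proof.
move=> phi1 epsd a0 uP au net.
have w0 : 0 < vnorm u := lt_le_trans a0 au.
have nx : vnorm ((vnorm u)^-1 *: u) = 1.
  by rewrite vnormZ ?invr_ge0 ?(ltW w0)// mulVf// gt_eqF.
have [|v [vV _ dv]] := net ((vnorm u)^-1 *: u); first by rewrite nx.
set x := (vnorm u)^-1 *: u in nx dv.
exists v; split=> //.
  rewrite ltrBlDr -nx; apply: le_lt_trans (_ : vnorm v + vnorm (x - v) < _).
    by rewrite -{1}(subrK v x) addrC ler_vnormD.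
  by rewrite ltrD2l.
move=> n.
have := PN_scale (th := a / vnorm u) epsd uP.
rewrite divr_ge0 ?(ltW a0) ?(ltW w0)//= ler_pdivrMr// mul1r => /(_ au n).
rewrite -scalerA -/x vdotZl => H.
have -> : a * vdot v (phi n) - eps n =
    (a * vdot x (phi n) - eps n) - a * vdot (x - v) (phi n).
  by rewrite vdotBl; ring.
apply: (le_trans (ler_normB _ _)); apply: lerD => //.
rewrite normrM (ger0_norm (ltW a0)) ler_pM2l//.
by apply: (le_trans (vdot_cauchy_schwarz _ _)); rewrite phi1 mulr1 ltW.
Qed.

(** On the segment, <th u, phi_n> is within [delta] of [eps n], which is itself at most [delta] in
    absolute value; the approximation adds [rho]. *)
Lemma PN_near (R : realType) d N (phi : 'I_N -> 'rV[R]_d) (eps : 'I_N -> R)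
    (delta th rho : R) (u v : 'rV[R]_d) :
  (forall n, vnorm (phi n) = 1) -> (forall n, `|eps n| <= delta) ->
  PN phi eps delta u -> 0 <= th <= 1 -> vnorm (th *: u - v) < rho ->
  forall n, `|vdot v (phi n)| <= 2 * delta + rho.
Proof.
move=> phi1 epsd uP th01 uv n.
have := PN_scale epsd uP th01 n.
have := epsd n; have := vdot_cauchy_schwarz (th *: u - v) (phi n).
rewrite phi1 mulr1 vdotBl !ler_norml => /andP[? ?] /andP[? ?] /andP[? ?].
apply/andP; split; lra.
Qed.

(** * Integration and independence *)

Section IntegralDomination.
Context {dT : measure_display} {T : measurableType dT} {R : realType}.
Variable P : probability T R.

(** The integral of a nonnegative function is a supremum over simple functions below it, hence
    monotone even for nonmeasurable integrands. This allows [WN], a supremum over an uncountable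
    set, to be integrated without a measurability proof. *)
Lemma ge0_le_integral_nonmeas (f g : T -> \bar R) :
  (forall w, 0 <= f w)%E -> (forall w, f w <= g w)%E ->
  (\int[P]_w f w <= \int[P]_w g w)%E.
Proof.
move=> f0 fg; have g0 w : (0 <= g w)%E := le_trans (f0 w) (fg w).
rewrite !ge0_integralTE//; apply: le_ereal_sup => _ [h /= hf <-].
by exists h => //= w; apply: le_trans (fg w).
Qed.

Lemma probE (A : set T) : measurable A -> P A = (fine (P A))%:E.
Proof. by move=> mA; rewrite fineK// fin_num_measure. Qed.

Lemma fine_prob_ge0 (A : set T) : 0 <= fine (P A).
Proof. by rewrite fine_ge0. Qed.

Lemma integral_indic_comb (s : seq (R * set T)) :
  (forall x, x \in s -> 0 <= x.1 /\ measurable x.2) ->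
  [/\ measurable_fun setT (fun w => \sum_(x <- s) x.1 * \1_(x.2) w),
      (forall w, 0 <= \sum_(x <- s) x.1 * \1_(x.2) w) &
      (\int[P]_w (\sum_(x <- s) x.1 * \1_(x.2) w)%:E =
       (\sum_(x <- s) x.1 * fine (P x.2))%:E)%E].
Proof.
elim: s => [|[c A] s IH] sP.
  split.
  - by under eq_fun do rewrite big_nil; exact: measurable_cst.
  - by move=> w; rewrite big_nil.
  - by under eq_integral do rewrite big_nil; rewrite integral0 big_nil.
have [|m ge int] := IH; first by move=> x xs; apply: sP; rewrite inE xs orbT.
have [/= c0 mA] := sP (c, A) (mem_head _ _).
have m1 : measurable_fun setT (fun w => c * \1_A w : R).
  by apply: measurable_funM => //; exact: measurable_indic.
have ge1 w : 0 <= c * \1_A w by rewrite mulr_ge0// indicE.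
split.
- by under eq_fun do rewrite big_cons; apply: measurable_funD.
- by move=> w; rewrite big_cons addr_ge0.
- under eq_integral do rewrite big_cons EFinD.
  rewrite ge0_integralD//; [|by move=> w _; rewrite lee_fin|exact/measurable_EFinP
    |by move=> w _; rewrite lee_fin|exact/measurable_EFinP].
  rewrite int big_cons EFinD; congr (_ + _)%E.
  under eq_integral do rewrite EFinM.
  rewrite ge0_integralZl_EFin; [| |move=> w _; rewrite lee_fin|apply/measurable_EFinP; exact: measurable_indic|] => //.
  by rewrite integral_indic// setIT EFinM -probE.
Qed.

(** Reduces a second moment to pointwise domination by weighted indicators, plus bounds on the
    probabilities of the events. *)
Lemma integral_le_indic_series (f : T -> \bar R) (S : nat -> seq (R * set T)) (B : R) :
  (forall i x, x \in S i -> 0 <= x.1 /\ measurable x.2) ->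
  (forall w, 0 <= f w)%E ->
  (forall w, f w <= \sum_(i <oo) (\sum_(x <- S i) x.1 * \1_(x.2) w)%:E)%E ->
  (forall n, \sum_(i < n) \sum_(x <- S i) x.1 * fine (P x.2) <= B) ->
  (\int[P]_w f w <= B%:E)%E.
Proof.
move=> SP f0 fS SB.
apply: (le_trans (ge0_le_integral_nonmeas f0 fS)).
rewrite integral_nneseries//; last 2 first.
- move=> i; have [m _ _] := integral_indic_comb (SP i).
  exact/measurable_EFinP.
- by move=> i w _; have [_ ge _] := integral_indic_comb (SP i); rewrite lee_fin.
apply: lime_le.
  apply: is_cvg_ereal_nneg_natsum_cond => i _ _; apply: integral_ge0 => w _.
  by have [_ ge _] := integral_indic_comb (SP i); rewrite lee_fin.
apply: nearW => n; rewrite big_mkord.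
under eq_bigr => i _ do have [_ _ ->] := integral_indic_comb (SP i).
by rewrite sumEFin lee_fin.
Qed.

Lemma prob_le_sum (I : eqType) (s : seq I) (F : I -> set T) (A : set T) :
  measurable A -> (forall i, measurable (F i)) ->
  (forall w, A w -> exists2 i, i \in s & F i w) ->
  fine (P A) <= \sum_(i <- s) fine (P (F i)).
Proof.
move=> + mF; elim: s A => [|i s IH] A mA AF.
  rewrite big_nil; have -> : A = set0 by apply/seteqP; split=> // w /AF[].
  by rewrite measure0.
rewrite big_cons; have mD : measurable (A `\` F i) by exact: measurableD.
apply: (@le_trans _ _ (fine (P (F i)) + fine (P (A `\` F i)))).
  rewrite -lee_fin EFinD -!probE//.
  apply: (@le_trans _ _ (P (F i `|` (A `\` F i)))); last exact: measureU2.
  apply: le_measure; rewrite ?inE//; first exact: measurableU.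
  by move=> w Aw; have [Fw|Fw] := pselect (F i w); [left|right].
rewrite lerD2l; apply: IH => // w [Aw nF].
have [j] := AF w Aw; rewrite inE => /predU1P[->//|js Fj].
by exists j.
Qed.

End IntegralDomination.

Section Measurability.
Import numFieldNormedType.Exports.
Context {R : realType} {d : nat}.

Lemma vec_borel_vdot (x : 'rV[R]_d) (B : set R) : measurable B ->
  vec_borel [set v | B (vdot x v)].
Proof.
move=> mB.
pose U : measurableType _ := g_sigma_algebraType (@vec_cyl R d).
have mcoord (i : 'I_d) : measurable_fun setT (fun v : U => (v : 'rV[R]_d) 0 i).
  move=> _ C mC; rewrite setTI; apply: sub_sigma_algebra.
  by exists i, C.
have mdot : measurable_fun setT (fun v : U => vdot x v : R).
  apply: measurable_sum => i; apply: measurable_funM => //.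
have := mdot measurableT B mB; rewrite setTI; exact.
Qed.

Lemma measurable_vdot {dT : measure_display} {T : measurableType dT}
    (X : T -> 'rV[R]_d) (x : 'rV[R]_d) :
  vec_measurable X -> measurable_fun setT (fun w => vdot x (X w)).
Proof.
by move=> mX; apply: measurable_sum => i; apply: measurable_funM => //; exact: mX.
Qed.

Lemma vec_borel_preimage {dT : measure_display} {T : measurableType dT}
    (X : T -> 'rV[R]_d) (S : set 'rV[R]_d) :
  vec_measurable X -> vec_borel S -> measurable (X @^-1` S).
Proof.
move=> mX mS.
pose U : measurableType _ := g_sigma_algebraType (@vec_cyl R d).
suff mXU : measurable_fun setT (X : T -> U).
  by rewrite -[X in measurable X]setTI; exact: mXU.
apply: (@measurability _ _ _ U _ _ (@vec_cyl R d)) => // _ [_ [i [B [mB ->]]] <-].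
by rewrite setTI -[X in measurable X]setTI; exact: mX.
Qed.

End Measurability.

Section Independence.
Context {dT : measure_display} {T : measurableType dT} {R : realType}.
Variable P : probability T R.
Variables (d N : nat) (phis : 'I_N -> T -> 'rV[R]_d) (eps : 'I_N -> T -> R).
Hypothesis mphis : forall n, vec_measurable (phis n).
Hypothesis meps : forall n, measurable_fun setT (eps n).
Hypothesis indep : mutually_independent P
    (fun k : 'I_N + 'I_N => match k with
                            | inl n => sigma_vec (phis n)
                            | inr n => sigma_real (eps n) end).

Lemma prob_rect (G : 'I_N -> set 'rV[R]_d) (E : 'I_N -> set R) :
  (forall n, vec_borel (G n)) -> (forall n, measurable (E n)) ->
  measurable [set w | forall n, G n (phis n w) /\ E n (eps n w)] /\
  fine (P [set w | forall n, G n (phis n w) /\ E n (eps n w)]) =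
  \prod_n (fine (P (phis n @^-1` G n)) * fine (P (eps n @^-1` E n))).
Proof.
move=> bG mE.
pose A (k : 'I_N + 'I_N) : set T := match k with
  | inl n => phis n @^-1` G n | inr n => eps n @^-1` E n end.
have mA k : measurable (A k).
  case: k => n /=; first exact: vec_borel_preimage.
  by rewrite -[X in measurable X]setTI; exact: meps.
have -> : [set w | forall n, G n (phis n w) /\ E n (eps n w)] =
    \bigcap_(k in [set k | k \in [set: 'I_N + 'I_N]%SET]) A k.
  apply/seteqP; split=> w /=.
    by move=> H [n|n] _; have [] := H n.
  by move=> H n; split; [apply: (H (inl n))|apply: (H (inr n))]; rewrite /= inE.
split; first by apply: fin_bigcap_measurable.
rewrite indep; last first.
  by case=> n _; [exists (G n)|exists (E n)].
have -> : (\prod_(k in [set: 'I_N + 'I_N]%SET) P (A k))%E =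
    (\prod_(k in [set: 'I_N + 'I_N]%SET) fine (P (A k)))%:E.
  by elim/big_rec2: _ => // k x y _ ->; rewrite EFinM -probE.
rewrite /=; under eq_bigl do rewrite inE.
by rewrite big_sumType/= big_split.
Qed.

(** [A] is covered by the rectangles indexed by choice functions from ['I_N] to [K]. The union bound
    sums products over all such functions, and distributivity turns this into a product of sums. *)
Lemma prob_forall_rect (K : finType) (G : 'I_N -> K -> set 'rV[R]_d)
    (E : 'I_N -> K -> set R) (A : set T) :
  measurable A -> (forall n k, vec_borel (G n k)) ->
  (forall n k, measurable (E n k)) ->
  (forall w, A w -> forall n, exists k, G n k (phis n w) /\ E n k (eps n w)) ->
  fine (P A) <= \prod_n \sum_k
    (fine (P (phis n @^-1` G n k)) * fine (P (eps n @^-1` E n k))).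
Proof.
move=> mA bG mE AK; rewrite bigA_distr_bigA/=.
pose F (c : {ffun 'I_N -> K}) :=
  [set w | forall n, G n (c n) (phis n w) /\ E n (c n) (eps n w)].
have FP c := prob_rect (fun n => bG n (c n)) (fun n => mE n (c n)).
under eq_bigr => c _ do rewrite -(FP c).2 -/(F c).
apply: prob_le_sum => //; first by move=> c; exact: (FP c).1.
move=> w /AK /choice[c cP]; exists [ffun n => c n]; first exact: mem_index_enum.
by move=> n; rewrite ffunE.
Qed.

End Independence.

(** * Probability estimates *)

Lemma measurable_abs_le (R : realType) (t : R) : measurable [set x : R | `|x| <= t].
Proof.
have -> : [set x : R | `|x| <= t] = [set` `[- t, t]].
  by apply/seteqP; split=> x /=; rewrite in_itv/= ler_norml.
exact: measurable_itv.
Qed.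

Lemma measurable_ge (R : realType) (t : R) : measurable [set x : R | t <= x].
Proof.
have -> : [set x : R | t <= x] = [set` `[t, +oo[].
  by apply/seteqP; split=> x /=; rewrite in_itv/= andbT.
exact: measurable_itv.
Qed.

Lemma measurable_le (R : realType) (t : R) : measurable [set x : R | x <= t].
Proof.
have -> : [set x : R | x <= t] = [set` `]-oo, t]].
  by apply/seteqP; split=> x /=; rewrite in_itv.
exact: measurable_itv.
Qed.

Section ProbabilityEstimates.
Context {dT : measure_display} {T : measurableType dT} {R : realType}.
Variable P : probability T R.
Variables (d N : nat) (phis : 'I_N -> T -> 'rV[R]_d) (eps : 'I_N -> T -> R).
Hypothesis mphis : forall n, vec_measurable (phis n).
Hypothesis meps : forall n, measurable_fun setT (eps n).
Hypothesis indep : mutually_independent P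
    (fun k : 'I_N + 'I_N => match k with
                            | inl n => sigma_vec (phis n)
                            | inr n => sigma_real (eps n) end).
Variable delta : R.
Hypothesis delta0 : 0 < delta.
Hypothesis unif : forall n (B : set R), measurable B ->
  P (eps n @^-1` B) =
  (lebesgue_measure (B `&` [set x : R | (- delta <= x <= delta)%R]) *
     ((2 * delta)^-1)%:E)%E.

Lemma measurable_forall_ord (A : 'I_N -> set T) :
  (forall n, measurable (A n)) -> measurable [set w | forall n, A n w].
Proof.
move=> mA; have -> : [set w | forall n, A n w] = \bigcap_(n in [set: 'I_N]) A n.
  by apply/seteqP; split=> w H n => [_|]; apply: H.
exact: fin_bigcap_measurable.
Qed.

Lemma measurable_vdot_le (v : 'rV[R]_d) (t : R) n :
  measurable [set w | `|vdot v (phis n w)| <= t].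
Proof.
rewrite -[X in measurable X]setTI.
exact: (measurable_vdot v (mphis n) measurableT (measurable_abs_le t)).
Qed.

Lemma measurable_slab (v : 'rV[R]_d) (a q : R) :
  measurable [set w | forall n, `|a * vdot v (phis n w) - eps n w| <= q].
Proof.
apply: measurable_forall_ord => n; rewrite -[X in measurable X]setTI.
have mf : measurable_fun setT (fun w => a * vdot v (phis n w) - eps n w).
  apply: measurable_funB => //; apply: measurable_funM => //.
  exact: measurable_vdot.
exact: (mf measurableT _ (measurable_abs_le q)).
Qed.

Lemma prob_eps_itv n (l u : R) : - delta <= l -> l <= u -> u <= delta ->
  forall B : set R, measurable B ->
  B `&` [set x | - delta <= x <= delta] = [set` `[l, u]] ->
  fine (P (eps n @^-1` B)) = (u - l) / (2 * delta).
Proof.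
move=> dl lu ud B mB Blu; rewrite unif// Blu lebesgue_measure_itv/= lte_fin.
case: ltP => [_|ul]; first by rewrite -EFinB -EFinM.
by have -> : u = l by [apply/eqP; rewrite eq_le ul lu]; rewrite subrr mul0r mul0e.
Qed.

Lemma prob_eps_ge n (p : R) : 0 <= p <= 1 ->
  fine (P (eps n @^-1` [set x | - delta + 2 * delta * p <= x])) = 1 - p.
Proof.
move=> /andP[p0 p1].
have h0 : 0 <= delta * p by rewrite mulr_ge0 ?(ltW delta0).
have h1 : delta * p <= delta by rewrite -[leRHS]mulr1 ler_pM2l.
have ml := measurable_ge (- delta + 2 * delta * p).
rewrite (@prob_eps_itv n (- delta + 2 * delta * p) delta)//;
  [by field; rewrite gt_eqF|lra|lra|].
apply/seteqP; split=> x /=; rewrite in_itv/=.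
  by move=> [h /andP[_ ->]]; rewrite andbT.
by move=> /andP[h ->]; split=> //; rewrite andbT; lra.
Qed.

Lemma prob_eps_le n (p : R) : 0 <= p <= 1 ->
  fine (P (eps n @^-1` [set x | x <= delta - 2 * delta * p])) = 1 - p.
Proof.
move=> /andP[p0 p1].
have h0 : 0 <= delta * p by rewrite mulr_ge0 ?(ltW delta0).
have h1 : delta * p <= delta by rewrite -[leRHS]mulr1 ler_pM2l.
have ml := measurable_le (delta - 2 * delta * p).
rewrite (@prob_eps_itv n (- delta) (delta - 2 * delta * p))//;
  [by field; rewrite gt_eqF|lra|lra|].
apply/seteqP; split=> x /=; rewrite in_itv/=.
  by move=> [h /andP[-> _]].
by move=> /andP[-> h]; split=> //=; lra.
Qed.

Lemma prob_eps_out : measurable [set w | exists n, delta < `|eps n w|] /\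
  fine (P [set w | exists n, delta < `|eps n w|]) = 0.
Proof.
pose F n := eps n @^-1` (~` [set` `[- delta, delta]]).
have mB : measurable (~` [set` `[- delta, delta]] : set R).
  by apply: measurableC; exact: measurable_itv.
have mF n : measurable (F n).
  by rewrite -[X in measurable X]setTI; exact: meps.
have F0 n : fine (P (F n)) = 0.
  rewrite /F unif//.
  rewrite (_ : [set x | - delta <= x <= delta] = [set` `[- delta, delta]]).
    by rewrite setICl measure0 mul0e.
  by apply/seteqP; split=> x /=; rewrite in_itv.
have -> : [set w | exists n, delta < `|eps n w|] = \bigcup_(n in [set: 'I_N]) F n.
  apply/seteqP; split=> w /=.
    move=> [n nd]; exists n => //=; rewrite /F/= in_itv/= -ler_norml.
    by move/(lt_le_trans nd); rewrite ltxx.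
  move=> [n _]; rewrite /F/= in_itv/= -ler_norml => /negP; rewrite -ltNge => h.
  by exists n.
have mU : measurable (\bigcup_(n in [set: 'I_N]) F n).
  exact: fin_bigcup_measurable.
split=> //; apply/eqP; rewrite eq_le fine_prob_ge0 andbT.
apply: le_trans (prob_le_sum P (s := index_enum 'I_N) mU mF _) _.
  by move=> w [n _ Fn]; exists n => //; exact: mem_index_enum.
by rewrite big1.
Qed.

Lemma tail_prob (v : 'rV[R]_d) (q b : R) :
  (forall n, fine (P [set w | `|vdot v (phis n w)| <= q]) <= b) ->
  measurable [set w | forall n, `|vdot v (phis n w)| <= q] /\
  fine (P [set w | forall n, `|vdot v (phis n w)| <= q]) <= b ^+ N.
Proof.
move=> hb.
have mA : measurable [set w | forall n, `|vdot v (phis n w)| <= q].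
  by apply: measurable_forall_ord => n; exact: measurable_vdot_le.
split=> //.
(* A single case with no condition on the noise leaves the product over the [phis n] alone. *)
apply: le_trans (prob_forall_rect (K := unit) mphis meps indep mA
  (G := fun _ _ => [set y | `|vdot v y| <= q]) (E := fun _ _ => setT) _ _ _) _.
- by move=> n k; exact: (vec_borel_vdot v (measurable_abs_le q)).
- by [].
- by move=> w Aw n; exists tt; split=> //; exact: Aw.
have -> : b ^+ N = \prod_(n < N) b by rewrite prodr_const card_ord.
apply: ler_prod => n _; rewrite big_const card_unit/= addr0 preimage_setT.
rewrite probability_setT mulr1 hb andbT; exact: fine_prob_ge0.
Qed.

(* Split according to whether <v, phi_n> is large positive, large negative or
   small: in the first two cases a slab constraint cuts off a proportion p of
   the values of eps_n. *)
Lemma bulk_prob (v : 'rV[R]_d) (a r t p : R) :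
  0 <= t -> 0 <= p <= 1 -> 0 <= a -> 2 * delta * p <= a * (t - r) ->
  (forall n, fine (P [set w | `|vdot v (phis n w)| <= t]) <= 1 / 2) ->
  fine (P [set w | forall n, `|a * vdot v (phis n w) - eps n w| <= delta + a * r])
    <= (1 - p / 2) ^+ N.
Proof.
move=> t0 p01 a0 pa half.
pose B k : set R := if k == 0 :> nat then [set x | t < x]
  else if k == 1 :> nat then [set x | x < - t] else [set x | `|x| <= t].
have mB k : measurable (B k).
  rewrite /B; case: ifP => _; last case: ifP => _.
  - have -> : [set x : R | t < x] = [set` `]t, +oo[].
      by apply/seteqP; split=> x /=; rewrite in_itv/= andbT.
    exact: measurable_itv.
  - have -> : [set x : R | x < - t] = [set` `]-oo, (- t)[].
      by apply/seteqP; split=> x /=; rewrite in_itv/=.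
    exact: measurable_itv.
  - exact: measurable_abs_le.
pose E k : set R := if k == 0 :> nat then [set x | - delta + 2 * delta * p <= x]
  else if k == 1 :> nat then [set x | x <= delta - 2 * delta * p] else setT.
have mE k : measurable (E k).
  rewrite /E; case: ifP => _; last case: ifP => _ //.
  - exact: measurable_ge.
  - exact: measurable_le.
have mG n k : measurable [set w | B k (vdot v (phis n w))].
  rewrite -[X in measurable X]setTI.
  exact: (measurable_vdot v (mphis n) measurableT (mB k)).
apply: le_trans (prob_forall_rect (K := 'I_3) mphis meps indep
  (measurable_slab v a _) (G := fun _ k => [set y | B k (vdot v y)])
  (E := fun _ k => E k) _ _ _) _.
- by move=> n k; exact: vec_borel_vdot.
- by move=> n k; exact: mE.
(* If <v, phi_n> > t, the slab forces eps_n >= a t - delta - a r >= -delta + 2 delta p; the negative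
   case is symmetric. *)
- move=> w Aw n; have := Aw n; rewrite ler_norml => /andP[A1 A2].
  have [x1|x1] := ltP t (vdot v (phis n w)).
    exists (@Ordinal 3 0 isT); split=> //; rewrite /E/=.
    have := ler_wpM2l a0 (ltW x1); lra.
  have [x2|x2] := ltP (vdot v (phis n w)) (- t).
    exists (@Ordinal 3 1 isT); split=> //; rewrite /E/=.
    have := ler_wpM2l a0 (ltW x2); lra.
  by exists (@Ordinal 3 2 isT); split; rewrite /B/E//= ler_norml x1 x2.
have -> : (1 - p / 2) ^+ N = \prod_(n < N) (1 - p / 2) by rewrite prodr_const card_ord.
apply: ler_prod => n _; apply/andP; split.
  by apply: sumr_ge0 => k _; rewrite mulr_ge0 ?fine_prob_ge0.
rewrite !big_ord_recl big_ord0/= /B /E /=.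
rewrite prob_eps_ge// prob_eps_le// preimage_setT probability_setT/=.
have /= m0 := mG n 0%N; have /= m1 := mG n 1%N; have /= m2 := mG n 2%N.
rewrite /B/= in m0 m1 m2.
have disj : fine (P [set w | t < vdot v (phis n w)]) +
    fine (P [set w | vdot v (phis n w) < - t]) +
    fine (P [set w | `|vdot v (phis n w)| <= t]) = 1.
  have -> : [set w | `|vdot v (phis n w)| <= t] =
      ~` ([set w | t < vdot v (phis n w)] `|` [set w | vdot v (phis n w) < - t]).
    apply/seteqP; split=> w /=; rewrite ler_norml.
      by move=> /andP[h1 h2] [|]; rewrite ltNge ?h1 ?h2.
    by move=> /not_orP[/negP + /negP]; rewrite -!leNgt => -> ->.
  have mU := measurableU _ _ m0 m1.
  apply: EFin_inj; rewrite !EFinD -!probE//; last exact: measurableC.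
  rewrite probability_setC// -measureU//; last first.
    by apply/seteqP; split=> // w /= [h1 h2]; lra.
  by rewrite addeC subeK// fin_num_measure.
(* With x, y, z the probabilities of the three cases, the factor is (x + y)(1 - p) + z = 1 - p (1 -
   z), and z <= 1/2. *)
have hn := half n; move/andP: p01 => [p0 p1].
move: disj hn; move: (fine _) (fine _) (fine _) => x y z xyz z2.
have := ler_wpM2l p0 z2; rewrite -[X in (_ <= X -> _)]/(_ * (1 / 2)).
have -> : x = 1 - y - z by move: xyz; lra.
lra.
Qed.

End ProbabilityEstimates.

(** * Numerical bounds *)

Lemma sum_geometric_le (R : realType) (q : R) n : 0 <= q < 1 ->
  \sum_(i < n) q ^+ i <= (1 - q)^-1.
Proof.
move=> /andP[q0 q1]; rewrite -[leRHS]mul1r ler_pdivlMr ?subr_gt0// mulrC.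
by rewrite -opprB mulNr -subrX1 opprB gerBl exprn_ge0.
Qed.

(** Put Q = (16 c)^d. The net has at most Q^2 points, and the constant 96 = 2 * 16 * 3 in [a0] makes
    (1 - p/2)^N <= exp(-N p / 2) = Q^(-3 * 2^i). As 3 * 2^i >= 2 i + 3 and Q >= 16, the product is
    at most 16^-(2 i + 1). Against 3 * 4^i * a0^2 this leaves (3/16) * 64^(-i) * a0^2. *)
Lemma bulk_term_le (R : realType) (d N i : nat) (delta c S : R) :
  (0 < d)%N -> (0 < N)%N -> 0 < delta -> 1 <= c -> S <= (6 * (1 + 4 * c)) ^+ d ->
  let a := 2 ^+ i * (96 * (d%:R * ln (16 * c)) * delta * c / N%:R) in
  a < 16 * delta * c ->
  3 * a ^+ 2 * (S * (1 - a / (16 * delta * c) / 2) ^+ N) <=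
  (96 * (d%:R * ln (16 * c)) * delta * c / N%:R) ^+ 2 / 4 * (1 / 8) ^+ i.
Proof.
move=> d0 N0 delta0 c1 Sd; set l := d%:R * ln _; set a0 := _ / N%:R => /= ac.
have c0 : 0 < c := lt_le_trans ltr01 c1.
have N0' : 0 < N%:R :> R by rewrite ltr0n.
have l0 : 0 <= l by rewrite mulr_ge0// ln_ge0//; move: c1; lra.
set Q := (16 * c) ^+ d.
have Q16 : 16 <= Q.
  apply: (@le_trans _ _ (16 * c)); first by move: c1; lra.
  rewrite -[leLHS]expr1 /Q ler_weXn2l//; move: c1; lra.
have Q0 : 0 < Q by apply: lt_le_trans Q16.
have expl : expR l = Q by rewrite /l expRM_natl lnK// posrE mulr_gt0.
have SQ : S <= Q ^+ 2.
  apply: (le_trans Sd); rewrite /Q -exprM mulnC exprM.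
  apply: lerXn2r; rewrite ?nnegrE ?exprn_ge0 ?mulr_ge0 ?addr_ge0 ?mulr_ge0 ?(ltW c0)//.
  have : c <= c ^+ 2 by rewrite expr2 ler_peMl ?(ltW c0).
  rewrite exprMn; move: c1; lra.
set p := _ / (16 * delta * c).
have p2 : 0 <= 1 - p / 2.
  have : p <= 1 by rewrite ler_pdivrMr ?mul1r ?(ltW ac)// !mulr_gt0.
  lra.
have pE : (1 - p / 2) ^+ N <= Q^-1 ^+ (3 * 2 ^ i).
  apply: (@le_trans _ _ (expR (- (p / 2)) ^+ N)).
    by apply: lerXn2r; rewrite ?nnegrE ?expR_ge0// expR_ge1Dx.
  rewrite -expRM_natl -expl -expRN -expRM_natl ler_expR.
  rewrite /p /a0 natrM natrX le_eqVlt; apply/orP; left; apply/eqP.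
  by field; rewrite !gt_eqF.
have e i' : (2 * i' + 1 + 2 <= 3 * 2 ^ i')%N.
  clear; elim: i' => // k; rewrite expnS; lia.
have Q1 : Q^-1 <= 16^-1 by rewrite lef_pV2 ?posrE.
have Qi0 : 0 <= Q^-1 by rewrite invr_ge0 ltW.
have SP : S * (1 - p / 2) ^+ N <= 16^-1 ^+ (2 * i + 1).
  apply: (@le_trans _ _ (Q ^+ 2 * Q^-1 ^+ (2 * i + 1 + 2))).
    apply: (@le_trans _ _ (Q ^+ 2 * (1 - p / 2) ^+ N)).
      by rewrite ler_wpM2r// exprn_ge0.
    rewrite (ler_wpM2l (exprn_ge0 2 (ltW Q0)))//; apply: (le_trans pE).
    rewrite ler_wiXn2l//; apply: (le_trans Q1); lra.
  rewrite exprD mulrCA -exprMn mulfV ?gt_eqF// expr1n mulr1.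
  by apply: lerXn2r; rewrite ?nnegrE.
have a20 : 0 <= 3 * (2 ^+ i * a0) ^+ 2 by rewrite mulr_ge0 ?sqr_ge0.
apply: (le_trans (ler_wpM2l a20 SP)).
have [q [q0 q8 qE]] : exists q : R, [/\ 0 <= q, q <= 1 / 8 & q = 2 ^+ 2 * 16^-1 ^+ 2].
  by exists (2 ^+ 2 * 16^-1 ^+ 2); split=> //; lra.
have -> : 3 * (2 ^+ i * a0) ^+ 2 * 16^-1 ^+ (2 * i + 1) =
    a0 ^+ 2 * (3 / 16 * q ^+ i).
  have -> : q ^+ i = (2 ^+ i) ^+ 2 * 16^-1 ^+ (2 * i) :> R.
    by rewrite (exprAC 2) exprM -exprMn qE.
  by rewrite exprD expr1; field.
rewrite -[leRHS]mulrA (ler_wpM2l (sqr_ge0 a0))//.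
have qi : q ^+ i <= (1 / 8) ^+ i.
  by apply: lerXn2r => //; rewrite nnegrE (le_trans q0).
have := exprn_ge0 i q0; move: qi; clear; lra.
Qed.

(** The hypothesis gives x >= 14 * 2^i * delta * c, so y = 4 delta c / x is at most (2/7) * 2^(-i).
    One of the d + 2 factors y absorbs the linear growth of the weight: it yields 8 delta^2 c (2 + 6
    delta / x) <= 8 * (17/7) delta^2 c. *)
Lemma tail_weight_le (R : realType) (d i : nat) (delta c x : R) :
  0 < delta -> 1 <= c -> 2 ^+ i * (16 * delta * c) - 2 * delta < x ->
  2 * delta * (2 * x + 3 * (2 * delta)) * (4 * delta * c / x) ^+ d.+2 <=
  136 / 7 * delta ^+ 2 * c * (2 / 7 * (1 / 2) ^+ i) ^+ d.+1.
Proof.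
move=> delta0 c1 hx.
have c0 : 0 < c := lt_le_trans ltr01 c1.
set p : R := 2 ^+ i in hx; have p1 : 1 <= p by rewrite exprn_ege1// ler1n.
have p0 : 0 < p := lt_le_trans ltr01 p1.
have cp1 : 1 <= p * c by rewrite -[leLHS]mulr1 ler_pM.
have dp : delta <= delta * (p * c) by rewrite ler_peMr// ltW.
have hx' : 14 * (delta * (p * c)) <= x by move: hx dp; lra.
have x14 : 14 * delta <= x by move: hx' dp; lra.
have x0 : 0 < x by apply: lt_le_trans x14; rewrite mulr_gt0.
set y := 4 * delta * c / x.
have y0 : 0 <= y by rewrite divr_ge0 ?(ltW x0)// !mulr_ge0 ?(ltW c0) ?(ltW delta0).
have yle : y <= 2 / 7 * (1 / 2) ^+ i.
  rewrite /y ler_pdivrMr// div1r exprVn -/p.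
  have -> : 2 / 7 * p^-1 * x = 2 / 7 * x / p by field; rewrite gt_eqF.
  by rewrite ler_pdivlMr//; move: hx'; lra.
rewrite exprS mulrA; apply: ler_pM; rewrite ?exprn_ge0//.
- by do 2![apply: mulr_ge0 => //]; move: x0 delta0; lra.
- have -> : 2 * delta * (2 * x + 3 * (2 * delta)) * y =
      8 * delta ^+ 2 * c * ((2 * x + 6 * delta) / x).
    by rewrite /y; field; rewrite gt_eqF.
  have -> : 136 / 7 * delta ^+ 2 * c = 8 * delta ^+ 2 * c * (17 / 7) by field.
  rewrite ler_pM2l ?ler_pdivrMr//; first by move: x14; lra.
  by rewrite !mulr_gt0// exprn_gt0.
- by apply: lerXn2r; rewrite ?nnegrE// (le_trans y0).
Qed.

(** The net has at most (102 * 2^i * c)^d points. Its d factors 2^i cancel all but one of the d + 1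
    factors 2^(-i), and the survivor makes the levels summable. Numerically 102 * 2/7 = 204/7 <= 32
    and (136/7) * (2/7) = 272/49 <= 16. *)
Lemma tail_count_le (R : realType) (d i : nat) (delta c S h : R) :
  0 < delta -> 1 <= c -> 0 <= h ->
  S <= (6 * (1 + 2 * (2 ^+ i * (16 * delta * c)) / (2 * delta))) ^+ d ->
  S * (136 / 7 * delta ^+ 2 * c * (2 / 7 * (1 / 2) ^+ i) ^+ d.+1 * h) <=
  (16 * delta ^+ 2 * 32 ^+ d * c ^+ d.+1 * h) * (1 / 2) ^+ i.
Proof.
move=> delta0 c1 h0 hS.
have c0 : 0 < c := lt_le_trans ltr01 c1.
set p : R := 2 ^+ i in hS; have p1 : 1 <= p by rewrite exprn_ege1// ler1n.
have p0 : 0 < p := lt_le_trans ltr01 p1.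
have cp1 : 1 <= p * c by rewrite -[leLHS]mulr1 ler_pM.
have ip : (1 / 2) ^+ i = p^-1 by rewrite div1r exprVn.
rewrite ip.
have S2 : S <= (102 * (p * c)) ^+ d.
  apply: (le_trans hS).
  have -> : 2 * (p * (16 * delta * c)) / (2 * delta) = 16 * (p * c).
    by field; rewrite gt_eqF.
  by apply: lerXn2r; rewrite ?nnegrE; move: cp1; lra.
apply: (@le_trans _ _ ((102 * (p * c)) ^+ d *
    (136 / 7 * delta ^+ 2 * c * (2 / 7 * p^-1) ^+ d.+1 * h))).
  have pi0 : 0 <= p^-1 by rewrite invr_ge0 ltW.
  have w0 : 0 <= 2 / 7 * p^-1 by move: pi0; clear; lra.
  have dc0 : 0 <= delta ^+ 2 * c := mulr_ge0 (sqr_ge0 _) (ltW c0).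
  apply: ler_wpM2r S2; apply: (mulr_ge0 _ h0).
  apply: (mulr_ge0 _ (exprn_ge0 _ w0)); move: dc0; clear; lra.
have regroup (A B k : R) :
    A ^+ d * (k * B ^+ d.+1 * h) = k * B * ((A * B) ^+ d * h).
  by rewrite exprS exprMn; ring.
rewrite regroup.
have -> : 102 * (p * c) * (2 / 7 * p^-1) = 204 / 7 * c.
  by field; rewrite gt_eqF.
have le32 : (204 / 7 * c) ^+ d <= 32 ^+ d * c ^+ d.
  rewrite -exprMn; apply: lerXn2r; rewrite ?nnegrE; move: c0; clear; lra.
have k0 : 0 <= delta ^+ 2 * c * p^-1.
  by apply: mulr_ge0; [exact: mulr_ge0 (sqr_ge0 _) (ltW c0)|rewrite invr_ge0 ltW].
set z := 32 ^+ d * c ^+ d in le32.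
have z0 : 0 <= z * h.
  by apply: mulr_ge0 => //; apply: mulr_ge0; apply: exprn_ge0; rewrite ?(ltW c0).
have -> : 16 * delta ^+ 2 * 32 ^+ d * c ^+ d.+1 * h * p^-1 =
    16 * (delta ^+ 2 * c * p^-1) * (z * h) by rewrite (exprS c d) /z; ring.
set k := delta ^+ 2 * c * p^-1 in k0 *.
have kE : 136 / 7 * delta ^+ 2 * c * (2 / 7 * p^-1) = 272 / 49 * k.
  by rewrite /k; field; rewrite gt_eqF.
apply: ler_pM.
- by rewrite kE; move: k0; clear; lra.
- by apply: mulr_ge0 => //; apply: exprn_ge0; move: c0; clear; lra.
- by rewrite kE; move: k0; clear; lra.
- exact: ler_wpM2r.
Qed.

Lemma sum_le_size (R : realType) (I : Type) (s : seq I) (Q : pred I) (F : I -> R) K :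
  0 <= K -> (forall i, Q i -> F i <= K) -> \sum_(i <- s | Q i) F i <= (size s)%:R * K.
Proof.
move=> K0 FK; elim: s => [|x s IH]; first by rewrite big_nil mul0r.
rewrite big_cons /= -natr1 mulrDl mul1r [leRHS]addrC.
case: ifP => Qx; first exact: lerD (FK _ Qx) IH.
by rewrite -[leLHS]add0r; exact: lerD.
Qed.

(** * The second moment *)

Section SecondMoment.
Context {dT : measure_display} {T : measurableType dT} {R : realType}.
Variable P : probability T R.
Variables (d N : nat) (phis : 'I_N -> T -> 'rV[R]_d) (eps : 'I_N -> T -> R).
Hypothesis mphis : forall n, vec_measurable (phis n).
Hypothesis meps : forall n, measurable_fun setT (eps n).
Hypothesis indep : mutually_independent P
    (fun k : 'I_N + 'I_N => match k with
                            | inl n => sigma_vec (phis n)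
                            | inr n => sigma_real (eps n) end).
Variable delta : R.
Hypothesis delta0 : 0 < delta.
Hypothesis unif : forall n (B : set R), measurable B ->
  P (eps n @^-1` B) =
  (lebesgue_measure (B `&` [set x : R | (- delta <= x <= delta)%R]) *
     ((2 * delta)^-1)%:E)%E.
Variables c s : R.
Hypotheses (d0 : (0 < d)%N) (N0 : (0 < N)%N) (c1 : 1 <= c) (s0 : 0 < s).
Hypothesis sN : d%:R + 2 <= s * N%:R.
Hypothesis phis1 : forall n w, vnorm (phis n w) = 1.
Hypothesis small_ball : forall n t x, 0 <= t <= 1 -> vnorm x = 1 ->
  fine (P [set w | `|vdot x (phis n w)| <= t]) <= (t * c) `^ s / 2.

Let c0 : 0 < c := lt_le_trans ltr01 c1.

Lemma small_ball_scaled n t (v : 'rV[R]_d) : 0 < vnorm v -> 0 <= t <= vnorm v ->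
  fine (P [set w | `|vdot v (phis n w)| <= t]) <= (t * c / vnorm v) `^ s / 2.
Proof.
move=> v0 /andP[t0 tv].
have := @small_ball n (t / vnorm v) ((vnorm v)^-1 *: v).
rewrite divr_ge0 ?vnorm_ge0//= ler_pdivrMr// mul1r => /(_ tv).
rewrite vnormZ ?invr_ge0 ?vnorm_ge0// mulVf ?gt_eqF// => /(_ erefl).
rewrite mulrAC; congr (fine (P _) <= _).
apply/seteqP; split=> w /=; rewrite vdotZl normrM ger0_norm ?invr_ge0 ?vnorm_ge0//;
  by rewrite mulrC ler_pM2r ?invr_gt0.
Qed.

(** [L0] is the norm where the bulk and tail regimes meet, [a0] the first bulk scale, and [r] the
    spacing of the net of the unit ball. If [a0 >= L0], no bulk level is active. *)
Let L0 := 16 * delta * c.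
Let a0 := 96 * (d%:R * ln (16 * c)) * delta * c / N%:R.
Let r := (4 * c)^-1.
Let slab (a : R) (v : 'rV[R]_d) : set T :=
  [set w | forall n, `|a * vdot v (phis n w) - eps n w| <= delta + a * r].
(** The width is the [2 * delta] forced by consistency plus the spacing [2 * delta] of the tail
    nets. *)
Let tube (v : 'rV[R]_d) : set T :=
  [set w | forall n, `|vdot v (phis n w)| <= 4 * delta].
Let escape : set T := [set w | exists n, delta < `|eps n w|].
(** The growth of the squared height charged to [v] in [dyadic_block] with [rho = 2 * delta]. *)
Let weight (v : 'rV[R]_d) := 2 * delta * (2 * vnorm v + 3 * (2 * delta)).

(** Apply [bulk_prob] with t = 1/(2 c) and p = a / L0. As |v| >= 3/4, the small ball bound at t is
    at most 1/2; and t - r = 1/(4 c) gives 2 delta p = a/(8 c) <= a (t - r). *)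
Lemma slab_prob (a : R) (v : 'rV[R]_d) : 0 <= a <= L0 -> 1 - r < vnorm v ->
  fine (P (slab a v)) <= (1 - a / L0 / 2) ^+ N.
Proof.
move=> /andP[aa aL] rv.
have L00 : 0 < L0 by rewrite !mulr_gt0.
have r4 : r <= 4^-1 by rewrite lef_pV2 ?posrE ?mulr_gt0//; move: c1; lra.
have v34 : 3 / 4 <= vnorm v by move: rv r4; lra.
have v0 : 0 < vnorm v by apply: lt_le_trans v34; lra.
have cinv : 0 < c^-1 <= 1 by rewrite invr_gt0 c0 invf_le1.
apply: (bulk_prob mphis meps indep delta0 unif (t := (2 * c)^-1)) => //.
- by rewrite invr_ge0 mulr_ge0 ?(ltW c0).
- by rewrite divr_ge0 ?(ltW L00)//= ler_pdivrMr// mul1r.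
- have -> : 2 * delta * (a / L0) = a * c^-1 / 8.
    by rewrite /L0; field; rewrite !gt_eqF.
  have -> : a * ((2 * c)^-1 - r) = a * c^-1 / 4 by rewrite /r; field; rewrite gt_eqF.
  have : 0 <= a * c^-1 by rewrite mulr_ge0 ?invr_ge0 ?(ltW c0).
  lra.
- have c2 : 0 <= (2 * c)^-1 by rewrite invr_ge0 mulr_ge0 ?(ltW c0).
  have c3 : (2 * c)^-1 <= vnorm v.
    by rewrite invfM; move: cinv v34 => /andP[_]; lra.
  move=> n; apply: (le_trans (small_ball_scaled n v0 _)); first by rewrite c2.
  have p1 : (1 : R) `^ s = 1 by rewrite powR1.
  rewrite ler_pM2r ?invr_gt0// -[leRHS]p1 ge0_ler_powR ?nnegrE ?(ltW s0)//.
    by rewrite divr_ge0 ?mulr_ge0 ?(ltW c0) ?(ltW v0).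
  have -> : (2 * c)^-1 * c / vnorm v = 1 / 2 / vnorm v.
    by field; rewrite !gt_eqF.
  by rewrite ler_pdivrMr//; move: v34; lra.
Qed.

(** The N factors y^s / 2 multiply to y^(s N) 2^(-N). Since y <= 1 and s N >= d + 2, the exponent
    can be lowered to d + 2. *)
Lemma tube_prob (v : 'rV[R]_d) : 4 * delta * c <= vnorm v ->
  measurable (tube v) /\
  fine (P (tube v)) <= (4 * delta * c / vnorm v) ^+ d.+2 * (1 / 2) ^+ N.
Proof.
move=> hv; set y := 4 * delta * c / vnorm v.
have k0 : 0 < 4 * delta * c by rewrite !mulr_gt0.
have v0 : 0 < vnorm v := lt_le_trans k0 hv.
have d4 : 4 * delta <= 4 * delta * c by rewrite ler_peMr// mulr_ge0 ?(ltW delta0).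
have hb n : fine (P [set w | `|vdot v (phis n w)| <= 4 * delta]) <= y `^ s / 2.
  apply: small_ball_scaled => //.
  by rewrite mulr_ge0 ?(ltW delta0)//= (le_trans d4).
have [mt pt] := tail_prob mphis meps indep hb.
split=> //; apply: (le_trans pt); rewrite exprMn mul1r ler_pM2r ?exprn_gt0 ?invr_gt0//.
have y01 : 0 < y <= 1 by rewrite divr_gt0//= ler_pdivrMr// mul1r.
have -> : (y `^ s) ^+ N = y `^ (s * N%:R) by rewrite powRrM powR_mulrn ?powR_ge0.
have -> : y ^+ d.+2 = y `^ (d%:R + 2).
  by rewrite -powR_mulrn ?(ltW (andP y01).1)// -addn2 natrD.
by rewrite ger_powR.
Qed.

(* The events and weights dominating |W_N|^2.  The weight 1 on the null event
   [escape] in every term makes the series infinite there, so that nothing has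
   to be said about W_N on it. *)
Let events (V1 : seq 'rV[R]_d) (V : nat -> seq 'rV[R]_d) i : seq (R * set T) :=
  [:: (if i == 0%N then a0 ^+ 2 else 0, setT); (1, escape)] ++
  [seq (3 * (2 ^+ i * a0) ^+ 2, slab (2 ^+ i * a0) v)
    | v <- V1 & (1 - r < vnorm v) && (2 ^+ i * a0 < L0)] ++
  [seq (weight v, tube v) | v <- V i & 2 ^+ i * L0 - 2 * delta < vnorm v].

(** Stated for an arbitrary [m] to serve both the expectation, with [m] the probability, and the
    pointwise bound, with [m] the indicator at [w]. *)
Lemma sum_events V1 V i (m : set T -> R) :
  \sum_(x <- events V1 V i) x.1 * m x.2 =
  (if i == 0%N then a0 ^+ 2 else 0) * m setT + m escape +
  \sum_(v <- V1 | (1 - r < vnorm v) && (2 ^+ i * a0 < L0))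
     3 * (2 ^+ i * a0) ^+ 2 * m (slab (2 ^+ i * a0) v) +
  \sum_(v <- V i | 2 ^+ i * L0 - 2 * delta < vnorm v) weight v * m (tube v).
Proof.
by rewrite /events !big_cons big_cat !big_map !big_filter/= mul1r !addrA.
Qed.

Lemma weight_ge0 v : 0 <= weight v.
Proof.
by rewrite mulr_ge0// ?addr_ge0 ?mulr_ge0 ?vnorm_ge0 ?(ltW delta0).
Qed.

Lemma L0_gt0 : 0 < L0. Proof. by rewrite !mulr_gt0. Qed.

Lemma a0_gt0 : 0 < a0.
Proof.
rewrite divr_gt0 ?ltr0n// !mulr_gt0 ?ltr0n// ln_gt0//; move: c1; lra.
Qed.

Lemma tube_radius (v : 'rV[R]_d) i :
  2 ^+ i * L0 - 2 * delta < vnorm v -> 4 * delta * c <= vnorm v.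
Proof.
have p1 : 1 <= 2 ^+ i :> R by rewrite exprn_ege1// ler1n.
have h1 := ler_wpM2r (ltW L0_gt0) p1.
have h2 : delta <= delta * c by rewrite ler_peMr// ltW.
move: h1 h2; rewrite mul1r; set pL := _ * L0; rewrite /L0; move: delta0; lra.
Qed.

Lemma events_ok V1 V i x : x \in events V1 V i -> 0 <= x.1 /\ measurable x.2.
Proof.
rewrite /events !inE mem_cat => /orP[/eqP->|/orP[/eqP->|/orP[]]].
- by split=> //=; case: ifP; rewrite ?sqr_ge0.
- by split=> //=; exact: (prob_eps_out meps unif).1.
- move=> /mapP[v _ ->]; split; first by rewrite mulr_ge0// sqr_ge0.
  exact: measurable_slab.
- move=> /mapP[v]; rewrite mem_filter => /andP[vx _] ->.
  by split; [exact: weight_ge0|exact: (tube_prob (tube_radius vx)).1].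
Qed.

Lemma bulk_mean_le V1 i : (size V1)%:R <= (6 * (1 + 4 * c)) ^+ d ->
  \sum_(v <- V1 | (1 - r < vnorm v) && (2 ^+ i * a0 < L0))
     3 * (2 ^+ i * a0) ^+ 2 * fine (P (slab (2 ^+ i * a0) v)) <=
  a0 ^+ 2 / 4 * (1 / 8) ^+ i.
Proof.
move=> hV; set a := 2 ^+ i * a0.
have a_0 : 0 < a by rewrite mulr_gt0 ?exprn_gt0 ?a0_gt0.
have [aL|La] := ltP a L0; last first.
  rewrite big1; last by move=> v; rewrite andbF.
  by rewrite mulr_ge0 ?exprn_ge0 ?divr_ge0 ?exprn_ge0 ?ltW ?a0_gt0 ?ltr01 ?ltr0n//.
have h := bulk_term_le d0 N0 delta0 c1 hV aL.
apply: le_trans _ h; rewrite [leRHS]mulrCA.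
apply: sum_le_size => [|v]; rewrite ?andbT.
  apply: mulr_ge0; first exact: mulr_ge0 (ler0n _ 3) (sqr_ge0 _).
  apply: exprn_ge0.
  have : a / (16 * delta * c) <= 1 by rewrite ler_pdivrMr ?L0_gt0// mul1r ltW.
  by move: (a / _) => q; lra.
move=> rv; apply: ler_wpM2l; first exact: mulr_ge0 (ler0n _ 3) (sqr_ge0 _).
by apply: slab_prob => //; rewrite !ltW.
Qed.

Lemma tail_mean_le (V : seq 'rV[R]_d) i :
  (size V)%:R <= (6 * (1 + 2 * (2 ^+ i * L0) / (2 * delta))) ^+ d ->
  \sum_(v <- V | 2 ^+ i * L0 - 2 * delta < vnorm v) weight v * fine (P (tube v)) <=
  16 * delta ^+ 2 * 32 ^+ d * c ^+ d.+1 * (1 / 2) ^+ N * (1 / 2) ^+ i.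
Proof.
move=> hV; have h0 : 0 <= (1 / 2) ^+ N :> R by rewrite exprn_ge0.
apply: le_trans _ (tail_count_le delta0 c1 h0 hV).
apply: sum_le_size => [|v vi].
  apply: mulr_ge0 => //; apply: mulr_ge0.
    have := mulr_ge0 (sqr_ge0 delta) (ltW c0); lra.
  apply: exprn_ge0; have : 0 <= (1 / 2) ^+ i :> R by rewrite exprn_ge0.
  lra.
have [_ pt] := tube_prob (tube_radius vi).
apply: (le_trans (ler_wpM2l (weight_ge0 v) pt)).
by rewrite mulrA ler_wpM2r// tail_weight_le.
Qed.

(** The ratios 1/8 and 1/2 sum to 8/7 and 2. This gives 1 + (1/4)(8/7) = 9/7 for the bulk, and 16 *
    2 = 32 raises the power of 32 to d + 1 in the tail. *)
Lemma sum_mean_le V1 (V : nat -> seq 'rV[R]_d) n :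
  (size V1)%:R <= (6 * (1 + 4 * c)) ^+ d ->
  (forall i, (size (V i))%:R <= (6 * (1 + 2 * (2 ^+ i * L0) / (2 * delta))) ^+ d) ->
  \sum_(i < n) \sum_(x <- events V1 V i) x.1 * fine (P x.2) <=
  9 / 7 * a0 ^+ 2 + delta ^+ 2 * 32 ^+ d.+1 * c ^+ d.+1 * (1 / 2) ^+ N.
Proof.
move=> hV1 hV.
pose tau := 16 * delta ^+ 2 * 32 ^+ d * c ^+ d.+1 * (1 / 2) ^+ N.
have tau0 : 0 <= tau.
  by rewrite !mulr_ge0 ?exprn_ge0 ?sqr_ge0 ?(ltW c0) ?(ltW delta0).
have a20 : 0 <= a0 ^+ 2 / 4 by rewrite divr_ge0 ?sqr_ge0.
apply: (@le_trans _ _ (\sum_(i < n) ((if i == 0%N :> nat then a0 ^+ 2 else 0) +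
    a0 ^+ 2 / 4 * (1 / 8) ^+ i + tau * (1 / 2) ^+ i))).
  apply: ler_sum => i _; rewrite (sum_events V1 V i (fun A => fine (P A))).
  rewrite probability_setT mulr1 (prob_eps_out meps unif).2 addr0.
  by apply: lerD (tail_mean_le _) => //; rewrite lerD2l bulk_mean_le.
rewrite !big_split/= -!mulr_sumr.
have s1 : \sum_(i < n) (if i == 0%N :> nat then a0 ^+ 2 else 0) <= a0 ^+ 2.
  case: n => [|n]; first by rewrite big_ord0 sqr_ge0.
  by rewrite big_ord_recl/= big1 ?addr0.
have s2 := ler_wpM2l a20 (@sum_geometric_le R (1 / 8) n ltac:(lra)).
have s3 := ler_wpM2l tau0 (@sum_geometric_le R (1 / 2) n ltac:(lra)).
have -> : delta ^+ 2 * 32 ^+ d.+1 * c ^+ d.+1 * (1 / 2) ^+ N = 2 * tau.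
  by rewrite /tau (exprS 32 d); ring.
apply: (le_trans (lerD (lerD s1 s2) s3)).
have -> : (1 - 1 / 8)^-1 = 8 / 7 :> R by field.
have -> : (1 - 1 / 2)^-1 = 2 :> R by field.
by rewrite le_eqVlt; apply/orP; left; apply/eqP; field.
Qed.

(** For N >= 1, (N + 1)(N + 2) <= 6 N^2, and (9/7) * 96^2 * 6 is about 71095, below 10^5. *)
Lemma main_term_le :
  9 / 7 * a0 ^+ 2 <=
  (10 ^+ 5 * delta ^+ 2 * d%:R ^+ 2 * c ^+ 2 * ln (16 * c) ^+ 2) /
    ((N%:R + 1) * (N%:R + 2)).
Proof.
have N1 : 1 <= N%:R :> R by rewrite ler1n.
have N0' : 0 < N%:R :> R by rewrite ltr0n.
pose k := (d%:R * ln (16 * c) * delta * c) ^+ 2.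
have k0 : 0 <= k by rewrite sqr_ge0.
rewrite ler_pdivlMr ?mulr_gt0 ?addr_gt0//.
have -> : 9 / 7 * a0 ^+ 2 * ((N%:R + 1) * (N%:R + 2)) =
    k * (9 / 7 * 96 ^+ 2 * ((N%:R + 1) * (N%:R + 2) / N%:R ^+ 2)).
  by rewrite /a0 /k; field; rewrite gt_eqF.
have -> : 10 ^+ 5 * delta ^+ 2 * d%:R ^+ 2 * c ^+ 2 * ln (16 * c) ^+ 2 =
    k * 10 ^+ 5 by rewrite /k; ring.
apply: ler_wpM2l => //.
have h6 : (N%:R + 1) * (N%:R + 2) / N%:R ^+ 2 <= 6 :> R.
  rewrite ler_pdivrMr ?exprn_gt0// expr2.
  have := ler_wpM2l (ltW N0') N1; move: N1; lra.
move: h6; set q := _ / N%:R ^+ 2; lra.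
Qed.

(** Split |u|^2 at min(|u|, L0)^2. The part below [L0] telescopes over the scales 2^i a0 and is
    charged to slabs, the rest over 2^i L0 and is charged to tubes. *)
Lemma events_dominate V1 (V : nat -> seq 'rV[R]_d) w u :
  (forall x, vnorm x <= 1 ->
    exists v, [/\ v \in V1, vnorm v <= vnorm x & vnorm (x - v) < r]) ->
  (forall i x, vnorm x <= 2 * (2 ^+ i * L0) ->
    exists v, [/\ v \in V i, vnorm v <= vnorm x & vnorm (x - v) < 2 * delta]) ->
  (forall n, `|eps n w| <= delta) -> PN (phis ^~ w) (eps ^~ w) delta u ->
  exists n, vnorm u ^+ 2 <=
    \sum_(i < n) \sum_(x <- events V1 V i) x.1 * \1_(x.2) w.
Proof.
move=> net1 net epsd uP.
(* Using the smaller scale lets the same number of levels exhaust both telescopes; taking [n1.+1]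
   levels guarantees that level 0, which carries [a0 ^+ 2], is present. *)
have [n1 hn] := @exists_dyadic_ge R (vnorm u) (Num.min a0 L0)
  ltac:(by rewrite lt_min a0_gt0 L0_gt0).
exists n1.+1; set n := n1.+1 in hn *.
pose bulk i : R := \sum_(v <- V1 | (1 - r < vnorm v) && (2 ^+ i * a0 < L0))
     3 * (2 ^+ i * a0) ^+ 2 * \1_(slab (2 ^+ i * a0) v) w.
pose tail i : R := \sum_(v <- V i | 2 ^+ i * L0 - 2 * delta < vnorm v)
     weight v * \1_(tube v) w.
have indic_ge0 (A : set T) : 0 <= \1_A w :> R by rewrite indicE.
pose w0 := Num.min (vnorm u) L0.
have hbulk i : Num.min w0 (2 * (2 ^+ i * a0)) ^+ 2 - Num.min w0 (2 ^+ i * a0) ^+ 2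
    <= bulk i.
  set a := 2 ^+ i * a0.
  have a_0 : 0 < a by rewrite mulr_gt0 ?exprn_gt0 ?a0_gt0.
  have g0 v : 0 <= 3 * a ^+ 2 * \1_(slab a v) w.
    exact: mulr_ge0 (mulr_ge0 (ler0n _ 3) (sqr_ge0 _)) (indic_ge0 _).
  have [wa|aw] := leP w0 a.
    rewrite min_l; first by rewrite subrr sumr_ge0.
    by move: wa a_0; lra.
  have [au aL] : a < vnorm u /\ a < L0 by move: aw; rewrite lt_min => /andP[].
  have [v [vV rv av]] :=
    PN_net_point (phis1 ^~ w) epsd a_0 uP (ltW au) net1.
  (* The square grows by at most (2 a)^2 - a^2, and one net point suffices to pay for it. *)
  apply: (@le_trans _ _ (3 * a ^+ 2)).
    have m0 : 0 <= Num.min w0 (2 * a) by rewrite le_min (ltW (lt_trans a_0 aw)); lra.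
    have : Num.min w0 (2 * a) ^+ 2 <= (2 * a) ^+ 2.
      by apply: lerXn2r;
        [rewrite nnegrE|rewrite nnegrE mulr_ge0 ?ltW|rewrite ge_min lexx orbT].
    by rewrite exprMn; lra.
  have -> : 3 * a ^+ 2 = \sum_(v' <- [:: v]) 3 * a ^+ 2 * \1_(slab a v') w.
    by rewrite big_seq1 indicE mem_set// mulr1.
  rewrite /bulk -/a -[leRHS]big_filter; apply: le_sum_sub_seq => // v'.
  by rewrite inE => /eqP ->; rewrite mem_filter rv aL.
have htail i : Num.min (vnorm u) (2 * (2 ^+ i * L0)) ^+ 2 -
    Num.min (vnorm u) (2 ^+ i * L0) ^+ 2 <= tail i.
  rewrite /tail big_mkcond/=.
  apply: (dyadic_block (rho := 2 * delta)); rewrite ?mulr_gt0 ?exprn_gt0 ?L0_gt0//.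
  - exact: net.
  - by move=> v; case: ifP => // _; rewrite mulr_ge0 ?weight_ge0.
  - move=> th v th01 uv hv; rewrite hv indicE mem_set ?mulr1//.
    move=> m; have := PN_near (phis1 ^~ w) epsd uP th01 uv m.
    by rewrite -mulrDl -natrD.
have n_ge (b : R) : Num.min a0 L0 <= b -> vnorm u <= 2 ^+ n * b.
  by move=> h; apply: (le_trans hn); rewrite ler_pM2l ?exprn_gt0.
have h1 := dyadic_telescope n hbulk.
have h2 := dyadic_telescope n htail.
rewrite (min_l (n_ge L0 _)) ?ge_min ?lexx ?orbT// in h2.
have w0n : w0 <= 2 ^+ n * a0.
  by rewrite ge_min n_ge// ge_min lexx.
rewrite (min_l w0n) -/w0 in h1.
under eq_bigr => i _ do rewrite (sum_events V1 V i (fun A => \1_A w : R)).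
rewrite -/w0 in h2.
apply: (le_trans h2); rewrite !big_split/=; apply: lerD => //.
have m0 : Num.min w0 a0 ^+ 2 <= a0 ^+ 2.
  apply: lerXn2r; rewrite ?nnegrE ?ge_min ?lexx ?orbT ?(ltW a0_gt0)//.
  by rewrite !le_min vnorm_ge0 (ltW L0_gt0) (ltW a0_gt0).
apply: (le_trans h1); apply: lerD => //; apply: (le_trans m0).
rewrite big_ord_recl/= big1 ?addr0; last by move=> i _; rewrite mul0r.
rewrite indicT mulr1 lerDl; exact: sumr_ge0.
Qed.

Lemma second_moment_bound :
  (\int[P]_w (`| WN (phis ^~ w) (eps ^~ w) delta | ^+ 2)
   <= ((10 ^+ 5 * delta ^+ 2 * d%:R ^+ 2 * c ^+ 2 * ln (16 * c) ^+ 2) /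
         ((N%:R + 1) * (N%:R + 2)) +
       delta ^+ 2 * 32 ^+ d.+1 * c ^+ d.+1 * (1 / 2) ^+ N)%:E)%E.
Proof.
have r0 : 0 < r by rewrite invr_gt0 mulr_gt0.
have [V1 [sV1 net1]] := @ball_net R d 1 r d0 ltr01 r0.
have /choice[V VP] : forall i, exists S : seq 'rV[R]_d,
    (size S)%:R <= (6 * (1 + 2 * (2 ^+ i * L0) / (2 * delta))) ^+ d /\
    forall u, vnorm u <= 2 * (2 ^+ i * L0) ->
      exists v, [/\ v \in S, vnorm v <= vnorm u & vnorm (u - v) < 2 * delta].
  by move=> i; apply: ball_net; rewrite ?mulr_gt0 ?exprn_gt0 ?L0_gt0.
apply: (@integral_le_indic_series _ _ _ P _ (events V1 V)).
- by move=> i x; exact: events_ok.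
- by move=> w; rewrite expe_ge0.
- move=> w; set F := fun i => \sum_(x <- events V1 V i) x.1 * \1_(x.2) w.
  have F0 i : (0 <= (F i)%:E)%E.
    rewrite lee_fin /F big_seq sumr_ge0// => x /events_ok[x0 _].
    by rewrite mulr_ge0// indicE.
  have partial n : ((\sum_(i < n) F i)%:E <= \sum_(i <oo) (F i)%:E)%E.
    by rewrite -sumEFin -(big_mkord xpredT (fun i => (F i)%:E)) nneseries_lim_ge.
  set G := (\sum_(i <oo) (F i)%:E)%E in partial *.
  have [[n nw]|nesc] := pselect (escape w).
    have F1 i : 1 <= F i.
      rewrite /F (sum_events V1 V i (fun A => \1_A w : R)).
      have -> : \1_escape w = 1 :> R by rewrite indicE mem_set//; exists n.
      have i0 (A : set T) : 0 <= \1_A w :> R by rewrite indicE.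
      have A0 : 0 <= (if i == 0%N then a0 ^+ 2 else 0) * \1_[set: T] w.
        by apply: mulr_ge0 => //; case: ifP; rewrite ?sqr_ge0.
      rewrite -addrA -[leLHS]add0r -[leLHS]addr0.
      apply: lerD; first by rewrite lerD2r.
      apply: addr_ge0; apply: sumr_ge0 => v _; apply: mulr_ge0 => //.
        exact: mulr_ge0 (ler0n _ 3) (sqr_ge0 _).
      exact: weight_ge0.
    have -> : G = +oo%E.
      (* Every term is at least 1, so the partial sums pass any [t]. *)
      apply/eqyP => t t0; apply: le_trans (partial (Num.truncn t).+1).
      rewrite lee_fin; apply: (le_trans (ltW (truncnS_gt t))).
      rewrite -[X in X%:R]card_ord -sumr_const; exact: ler_sum.
    by rewrite leey.
  have epsd n : `|eps n w| <= delta.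
    by rewrite leNgt; apply/negP => h; apply: nesc; exists n.
  case GE : G partial => [g| |] partial; [|by rewrite leey|by have := partial 0%N].
  (* When the series has a finite value [g], it bounds every |u|^2 with [u] consistent, so [sqrt g]
     bounds the supremum. *)
  have ug u : PN (phis ^~ w) (eps ^~ w) delta u -> vnorm u <= Num.sqrt g.
    move=> uP.
    have [n hn] := events_dominate net1 (fun i => (VP i).2) epsd uP.
    rewrite -[leLHS]ger0_norm ?vnorm_ge0// -sqrtr_sqr ler_wsqrtr//.
    by apply: (le_trans hn); rewrite -lee_fin.
  have g0 : 0 <= g by have := partial 0%N; rewrite big_ord0 lee_fin.
  have W1 : (WN (phis ^~ w) (eps ^~ w) delta <= (Num.sqrt g)%:E)%E.
    by apply: ge_ereal_sup => _ [u uP <-]; rewrite lee_fin ug.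
  (* Off [escape], 0 is consistent, so the supremum is not over the empty set, where it would be
     -oo. *)
  have W0 : (0 <= WN (phis ^~ w) (eps ^~ w) delta)%E.
    have PN0 : PN (phis ^~ w) (eps ^~ w) delta 0.
      by move=> n; rewrite /vdot big1 ?sub0r ?normrN// => i _; rewrite mxE mul0r.
    apply: (@le_trans _ _ (vnorm (0 : 'rV[R]_d))%:E).
      by rewrite lee_fin vnorm_ge0.
    by apply: ereal_sup_ubound; exists 0.
  move: W0 W1; case: (WN _ _ _) => [x| |]//; rewrite !lee_fin => x0 xg.
  rewrite ger0_norm// -expr2 -[leRHS]sqr_sqrtr//.
  by apply: lerXn2r; rewrite ?nnegrE ?sqrtr_ge0.
- have sV1' : (size V1)%:R <= (6 * (1 + 4 * c)) ^+ d.
    by move: sV1; rewrite div1r /r invrK.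
  move=> n; apply: (le_trans (sum_mean_le n sV1' (fun i => (VP i).1))).
  by apply: lerD => //; exact: main_term_le.
Qed.

End SecondMoment.

(** * Normalisation of the small ball condition and conclusion *)

Unset Implicit Arguments.

Theorem theorem5p5 (R : realType) (dT : measure_display) (T : measurableType dT)
  (P : probability T R) (d N : nat) (delta alpha s : R)
  (phi : T -> 'rV[R]_d) (phis : 'I_N -> T -> 'rV[R]_d) (eps : 'I_N -> T -> R) :
  (1 <= d)%N -> 0 < delta -> 1 <= alpha -> 0 < s ->
  (* phi is a random vector on the unit sphere S^{d-1} *)
  vec_measurable phi -> (forall t, vnorm (phi t) = 1) ->
  (* small-ball condition *)
  (forall (t : R) (x : 'rV[R]_d), 0 <= t <= 1 -> vnorm x = 1 ->
     (P [set w | (`|vdot x (phi w)| <= t)%R] <= (alpha * t `^ s)%:E)%E) ->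
  (* phi_1..phi_N are copies of phi *)
  (forall n, vec_measurable (phis n)) ->
  (forall n t, vnorm (phis n t) = 1) ->
  (forall n S, @vec_borel R d S -> P (phis n @^-1` S) = P (phi @^-1` S)) ->
  (* eps_1..eps_N uniform on [-delta, delta] *)
  (forall n, measurable_fun setT (eps n)) ->
  (forall n (B : set R), measurable B ->
     P (eps n @^-1` B) =
     (lebesgue_measure (B `&` [set x : R | (- delta <= x <= delta)%R]) * ((2 * delta)^-1)%:E)%E) ->
  (* phi_1..phi_N, eps_1..eps_N mutually independent *)
  mutually_independent P
    (fun k : 'I_N + 'I_N => match k with
                            | inl n => sigma_vec (phis n)
                            | inr n => sigma_real (eps n) end) ->
  (d%:R + 2) / s <= N%:R ->
  (\int[P]_w (`| WN (fun n => phis n w) (fun n => eps n w) delta | ^+ 2)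
   <= ((10 ^+ 5 * delta ^+ 2 * d%:R ^+ 2 * (2 * alpha) `^ (2 / s)
         * (ln (16 * (2 * alpha) `^ (1 / s))) ^+ 2)
        / ((N%:R + 1) * (N%:R + 2))
       + delta ^+ 2 * 32 ^+ d.+1 * (2 * alpha) `^ (d.+1%:R / s) * (1 / 2) ^+ N)%:E)%E.
Proof.
move=> d0 delta0 alpha1 s0 mphi _ small mphis phis1 law meps unif indep Ns.
have sN : d%:R + 2 <= s * N%:R by rewrite mulrC -ler_pdivrMr.
have N0 : (0 < N)%N.
  rewrite -(ltr_nat R); apply: lt_le_trans Ns.
  by rewrite divr_gt0// ltr_wpDl.
have a2 : 0 < 2 * alpha by lra.
(* This [c] absorbs [alpha]: alpha t^s = (t c)^s / 2, and the powers of 2 alpha in the bound become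
   natural powers of [c]. *)
set c := (2 * alpha) `^ (1 / s).
have cX k : (2 * alpha) `^ (k%:R / s) = c ^+ k.
  by rewrite /c -powR_mulrn ?powR_ge0// -powRrM mul1r (mulrC k%:R).
have c1 : 1 <= c.
  have p1 : (1 : R) `^ (1 / s) = 1 by rewrite powR1.
  rewrite -[leLHS]p1; apply: ge0_ler_powR; rewrite ?nnegrE ?divr_ge0 ?(ltW s0)//; lra.
have small' n t x : 0 <= t <= 1 -> vnorm x = 1 ->
    fine (P [set w | `|vdot x (phis n w)| <= t]) <= (t * c) `^ s / 2.
  move=> /andP[t0 t1] x1.
  have mt := measurable_abs_le t.
  have /= -> := law n _ (vec_borel_vdot x mt).
  have -> : (t * c) `^ s / 2 = alpha * t `^ s.
    have cs : c `^ s = 2 * alpha.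
      by rewrite /c -powRrM div1r mulVf ?gt_eqF// powRr1// ltW.
    by rewrite powRM ?powR_ge0// cs; field.
  rewrite -lee_fin -probE; first by apply: small; rewrite ?t0.
  exact: vec_borel_preimage mphi (vec_borel_vdot x mt).
rewrite (cX 2%N) (cX d.+1).
apply: le_trans
  (second_moment_bound mphis meps indep delta0 unif d0 N0 c1 s0 sN phis1 small') _.
exact: lexx.
Qed.
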